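(* The quantum affine isometry groups of the basic noncommutative cubes $\widehat{\mathbb Z_2^N}\subset\widehat{\mathbb Z_2^{\circ N}}\subset\widehat{\mathbb Z_2^{*N}}$ are $$G^+(\widehat{\mathbb Z_2^N})=\bar O_N,\qquad G^+(\widehat{\mathbb Z_2^{\circ N}})=H_N^*,\qquad G^+(\widehat{\mathbb Z_2^{*N}})=H_N^+,$$ with $H_N^*\subset H_N^+$ being an inclusion (and with no inclusion map between $\bar O_N$ and $H_N^*$).
   Context: $O_N^+$ is Wang's free orthogonal quantum group: $C(O_N^+)$ is the universal $C^*$-algebra generated by the entries of an $N\times N$ matrix $u=(u_{ij})$ with $u=\bar u$, $u^t=u^{-1}$, with $\Delta(u_{ij})=\sum_ku_{ik}\otimes u_{kj}$. Closed quantum subgroups $G\subset O_N^+$ correspond to quotients $C(G)$ of $C(O_N^+)$ to which the quantum group structure factors; the images of the $u_{ij}$ are still denoted $u_{ij}$. The following are such subgroups: - $\bar O_N\subset O_N^+$: relations, for $a,b\in\{u_{ij}\}$, $ab=-ba$ for $a\neq b$ on the same row or column of $u$, and $ab=ba$ otherwise. - $H_N^+\subset O_N^+$: relations $ab=0$ for $a\neq b\in\{u_{ij}\}$ on the same row or column of $u$. - $H_N^*\subset H_N^+$: the additional half-commutation relations $abc=cba$ for all $a,b,c\in\{u_{ij}\}$. The free real sphere is $C(S^{N-1}_{\mathbb R,+})=C^*(x_1,\ldots,x_N\mid x_i=x_i^*,\ \sum_ix_i^2=1)$; a closed subset $X\subset S^{N-1}_{\mathbb R,+}$ corresponds to a quotient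 $C(X)$. For a group $\Gamma=\langle g_1,\ldots,g_N\rangle$ generated by elements with $g_i^2=1$, the dual $\widehat\Gamma$, given by $C(\widehat\Gamma)=C^*(\Gamma)$, is viewed as a subset of $S^{N-1}_{\mathbb R,+}$ via $x_i=g_i/\sqrt N$. The group $\mathbb Z_2^{\circ N}$ is the quotient of the free product $\mathbb Z_2^{*N}$ by the relations $abc=cba$ between standard generators $a,b,c\in\{g_1,\ldots,g_N\}$. A quantum group $G\subset O_N^+$ acts affinely on $X\subset S^{N-1}_{\mathbb R,+}$, written $G\curvearrowright X$, if $\Phi(x_i)=\sum_ju_{ij}\otimes x_j$ defines a coaction map $\Phi:C(X)\to C(G)\otimes C(X)$. The quantum affine isometry group is $G^+(X)=\max\{G\subset O_N^+\mid G\curvearrowright X\}$, the biggest quantum subgroup of $O_N^+$ acting affinely on $X$. *)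

(* Defs.v *)
From HB Require Import structures.
From mathcomp Require Import all_boot all_order all_algebra all_fingroup.
From mathcomp Require Import generic_quotient complex.
From mathcomp Require Import all_classical all_reals.
Import Order.TTheory GRing.Theory Num.Theory.

Set Implicit Arguments.
Unset Strict Implicit.
Unset Printing Implicit Defensive.

Local Open Scope classical_set_scope.
Local Open Scope ring_scope.

(* The norm is part of the mixin since Hierarchy Builder does not accept a join
   of [normedModType] and [algType]. The algebras of [algType] are unital and
   nonzero. *)
HB.mixin Record Algebra_isCStar (R : realType) A of GRing.Algebra R[i] A := {
  star : A -> A;
  starK : involutive star;
  starD : {morph star : a b / a + b};
  starZ : forall (c : R[i]) (a : A), star (c *: a) = c^* *: star a;
  starM : forall a b : A, star (a * b) = star b * star a;
  cnorm : A -> R;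
  cnorm_eq0 : forall a : A, cnorm a = 0 -> a = 0;
  cnormD : forall a b : A, cnorm (a + b) <= cnorm a + cnorm b;
  cnormZ : forall (c : R[i]) (a : A),
    (cnorm (c *: a))%:C%C = `|c| * (cnorm a)%:C%C;
  cnormM : forall a b : A, cnorm (a * b) <= cnorm a * cnorm b;
  cnorm_starM : forall a : A, cnorm (star a * a) = cnorm a ^+ 2;
  cnorm_complete : forall a_ : nat -> A,
    (forall e : R, 0 < e ->
       exists n, forall p q, (n <= p)%N -> (n <= q)%N -> cnorm (a_ p - a_ q) < e) ->
    exists a : A, forall e : R, 0 < e ->
      exists n, forall p, (n <= p)%N -> cnorm (a_ p - a) < e
}.

#[short(type="cstarAlgType")]
HB.structure Definition CStarAlgebra (R : realType) :=
  {A of GRing.Algebra R[i] A & Algebra_isCStar R A}.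

Section CStarTheory.
Variable R : realType.
Implicit Types A B T : cstarAlgType R.

(* [f] is only assumed to be a unital algebra morphism commuting with the
   involution: such maps are automatically contractive. *)
Definition star_preserving A B (f : {lrmorphism A -> B}) : Prop :=
  forall a : A, f (star a) = star (f a).

Definition norm_closed A (S : set A) : Prop :=
  forall a, (forall e : R, 0 < e -> exists2 b, S b & cnorm (b - a) < e) -> S a.

Definition closed_star_subalgebra A (S : set A) : Prop :=
  [/\ norm_closed S, S 1,
      (forall (c : R[i]) a b, S a -> S b -> S (c *: a + b)),
      (forall a b, S a -> S b -> S (a * b)) &
      (forall a, S a -> S (star a))].

Definition generates A (G : set A) : Prop :=
  smallest (@closed_star_subalgebra A) G = [set: A].

(* [P B b] expresses that the family [b] of elements of [B] satisfies given
   relations; [a] then generates C*(a_i, i in I | P). *)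
Definition universal_cstar (I : Type)
    (P : forall B : cstarAlgType R, (I -> B) -> Prop) A (a : I -> A) : Prop :=
  [/\ P A a, generates (range a) &
      forall (B : cstarAlgType R) (b : I -> B), P B b ->
        exists2 f : {lrmorphism A -> B}, star_preserving f &
          forall i, f (a i) = b i].

(* The maximal tensor product: the universal C*-algebra generated by commuting
   copies of [A] and [B], where [iA a] and [iB b] are a (x) 1 and 1 (x) b, so
   that a (x) b is [iA a * iB b]. *)
Definition max_tensor A B T (iA : {lrmorphism A -> T}) (iB : {lrmorphism B -> T})
    : Prop :=
  [/\ star_preserving iA /\ star_preserving iB,
      (forall a b, iA a * iB b = iB b * iA a),
      generates (range iA `|` range iB) &
      forall (T' : cstarAlgType R)
        (jA : {lrmorphism A -> T'}) (jB : {lrmorphism B -> T'}),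
        star_preserving jA -> star_preserving jB ->
        (forall a b, jA a * jB b = jB b * jA a) ->
        exists2 f : {lrmorphism T -> T'}, star_preserving f &
          (forall a, f (iA a) = jA a) /\ (forall b, f (iB b) = jB b)].

Definition unitary_rep (Gam : groupType) A (pi : Gam -> A) : Prop :=
  [/\ pi 1%g = 1, (forall g h, pi (g * h)%g = pi g * pi h) &
      forall g, star (pi g) * pi g = 1 /\ pi g * star (pi g) = 1].

Definition group_cstar (Gam : groupType) A (pi : Gam -> A) : Prop :=
  universal_cstar (@unitary_rep Gam) pi.

End CStarTheory.

(* A quantum subgroup G of O_N^+, or a closed subset X of the free sphere, is
   given by its C*-algebra with distinguished generators. An inclusion ([qsub],
   [ssub] below) is a morphism in the opposite direction mapping generators to
   generators; it has dense, hence full, range. *)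

Record qmatrix (R : realType) (N : nat) := QMatrix {
  qalg :> cstarAlgType R;
  qfund : 'M[qalg]_N
}.

Record qspace (R : realType) (N : nat) := QSpace {
  salg :> cstarAlgType R;
  scoord : 'I_N -> salg
}.

Section QuantumGroups.
Variables (R : realType) (N : nat).

(* u = \bar u and u^t = u^{-1} *)
Definition orthogonal_rel (A : cstarAlgType R) (u : 'M[A]_N) : Prop :=
  [/\ map_mx star u = u, u *m u^T = 1%:M & u^T *m u = 1%:M].

(* C(G) is a quotient of C(O_N^+), i.e. it is generated by the entries of an
   orthogonal matrix [u], and the comultiplication, the counit and the antipode
   of O_N^+ factor through it. The antipode, a morphism from C(G) to the
   opposite algebra, is a linear antimultiplicative map. *)
Definition quantum_subgroup (G : qmatrix R N) : Prop :=
  let u := qfund G in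
  [/\ orthogonal_rel u,
      generates [set u ij.1 ij.2 | ij in [set: 'I_N * 'I_N]],
      (exists (T : cstarAlgType R) (i1 i2 : {lrmorphism G -> T}),
        max_tensor i1 i2 /\
        exists2 Delta : {lrmorphism G -> T}, star_preserving Delta &
          forall i j, Delta (u i j) = \sum_(k < N) i1 (u i k) * i2 (u k j)),
      (exists2 eps : {lrmorphism G -> (R[i])^o},
          (forall a, eps (star a) = (eps a)^*) &
          forall i j, eps (u i j) = (i == j)%:R) &
      (exists S : {linear G -> G},
        [/\ S 1 = 1, (forall a b, S (a * b) = S b * S a),
            (forall a, S (star a) = star (S a)) &
            forall i j, S (u i j) = u j i])].

Definition qsub (G H : qmatrix R N) : Prop :=
  exists2 f : {lrmorphism H -> G}, star_preserving f &
    forall i j, f (qfund H i j) = qfund G i j.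

Definition qgroup_presented_by
    (P : forall A : cstarAlgType R, 'M[A]_N -> Prop) (G : qmatrix R N) : Prop :=
  universal_cstar
    (fun A (a : 'I_N * 'I_N -> A) =>
       let u := \matrix_(i, j) a (i, j) in orthogonal_rel u /\ P A u)
    (fun ij => qfund G ij.1 ij.2).

Definition barO_rel (A : cstarAlgType R) (u : 'M[A]_N) : Prop :=
  [/\ (forall i j l, j != l -> u i j * u i l = - (u i l * u i j)),
      (forall i k j, i != k -> u i j * u k j = - (u k j * u i j)) &
      (forall i j k l, i != k -> j != l -> u i j * u k l = u k l * u i j)].

Definition Hplus_rel (A : cstarAlgType R) (u : 'M[A]_N) : Prop :=
  (forall i j l, j != l -> u i j * u i l = 0) /\
  (forall i k j, i != k -> u i j * u k j = 0).

Definition Hstar_rel (A : cstarAlgType R) (u : 'M[A]_N) : Prop :=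
  Hplus_rel u /\
  forall i j k l p q, u i j * u k l * u p q = u p q * u k l * u i j.

Definition is_barO : qmatrix R N -> Prop := qgroup_presented_by barO_rel.
Definition is_Hplus : qmatrix R N -> Prop := qgroup_presented_by Hplus_rel.
Definition is_Hstar : qmatrix R N -> Prop := qgroup_presented_by Hstar_rel.

Definition sphere_subset (X : qspace R N) : Prop :=
  [/\ (forall i, star (scoord X i) = scoord X i),
      \sum_(i < N) scoord X i ^+ 2 = 1 &
      generates (range (scoord X))].

Definition ssub (X Y : qspace R N) : Prop :=
  exists2 f : {lrmorphism Y -> X}, star_preserving f &
    forall i, f (scoord Y i) = scoord X i.

(* The coassociativity and counit axioms of a coaction need not be required:
   the two sides agree on the generators x_i. *)
Definition acts_affinely (G : qmatrix R N) (X : qspace R N) : Prop :=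
  exists (T : cstarAlgType R) (iG : {lrmorphism G -> T})
         (iX : {lrmorphism X -> T}),
    max_tensor iG iX /\
    exists2 Phi : {lrmorphism X -> T}, star_preserving Phi &
      forall i, Phi (scoord X i) = \sum_(j < N) iG (qfund G i j) * iX (scoord X j).

Definition quantum_affine_isometry_group (X : qspace R N) (G : qmatrix R N) : Prop :=
  [/\ quantum_subgroup G, acts_affinely G X &
      forall H, quantum_subgroup H -> acts_affinely H X -> qsub H G].

Definition is_dual (Gam : groupType) (g : 'I_N -> Gam) (X : qspace R N) : Prop :=
  exists2 pi : Gam -> X, group_cstar pi &
    forall i, scoord X i = (sqrtC (N%:R : R[i]))^-1 *: pi (g i).

End QuantumGroups.

Section Z2Products.
Variable N : nat.

(* The group law of ['Z_2] is the addition. *)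
Definition Z2pow : groupType := {dffun forall _ : 'I_N, 'Z_2}.

Definition Z2pow_gen (i : 'I_N) : Z2pow := [ffun j => (j == i)%:R : 'Z_2].

Section Presented.
Variable rel : seq 'I_N -> seq 'I_N -> Prop.

(* Z_2^{* N} and its quotients are groups of words in the generators g_i: since
   g_i = g_i^{-1}, words with letters in 'I_N are enough, and the inverse of a
   word is its reversal. *)
Inductive word_cong : seq 'I_N -> seq 'I_N -> Prop :=
| word_cong_refl s : word_cong s s
| word_cong_sym s t : word_cong s t -> word_cong t s
| word_cong_trans s t v : word_cong s t -> word_cong t v -> word_cong s v
| word_cong_cat s s' t t' :
    word_cong s s' -> word_cong t t' -> word_cong (s ++ t) (s' ++ t')
| word_cong_invol i : word_cong [:: i; i] [::]
| word_cong_rel s t : rel s t -> word_cong s t.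

Lemma word_cong_rev_cat s : word_cong (rev s ++ s) [::].
Proof.
elim: s => [|i s IHs]; first exact: word_cong_refl.
rewrite rev_cons -cats1 -catA /=; apply: word_cong_trans IHs.
apply: word_cong_cat (word_cong_refl _) _.
by apply: (word_cong_cat (word_cong_invol i)); apply: word_cong_refl.
Qed.

Lemma word_cong_cat_rev s : word_cong (s ++ rev s) [::].
Proof. by rewrite -{1}[s]revK; apply: word_cong_rev_cat. Qed.

Lemma word_cong_rev s t : word_cong s t -> word_cong (rev s) (rev t).
Proof.
move=> st; have e1 : word_cong (rev s ++ (t ++ rev t)) (rev s).
  rewrite -{2}[rev s]cats0.
  exact: word_cong_cat (word_cong_refl _) (word_cong_cat_rev _).
have e2 : word_cong (rev s ++ (t ++ rev t)) (rev t).
  rewrite catA -[X in word_cong _ X]cat0s.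
  apply: word_cong_cat (word_cong_refl _).
  apply: word_cong_trans (word_cong_rev_cat s).
  exact: word_cong_cat (word_cong_refl _) (word_cong_sym st).
exact: word_cong_trans (word_cong_sym e1) e2.
Qed.

Definition word_eqb (s t : seq 'I_N) : bool := `[< word_cong s t >].

Lemma word_eqb_equiv : equiv_class_of word_eqb.
Proof.
split => [s|s t|t s v].
- exact/asboolP/word_cong_refl.
- by apply/asboolP/asboolP; apply: word_cong_sym.
- by move=> /asboolP st /asboolP tv; apply/asboolP; apply: word_cong_trans st tv.
Qed.

Canonical word_eqb_equivRel := EquivRelPack word_eqb_equiv.

Definition word_group := {eq_quot word_eqb}%qT.
HB.instance Definition _ := Choice.on word_group.
HB.instance Definition _ := EqQuotient.on word_group.

Definition wclass : seq 'I_N -> word_group := (\pi_word_group)%qT.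

Lemma wclass_eqP s t : wclass s = wclass t <-> word_cong s t.
Proof. by split => [/eqmodP/asboolP//|st]; apply/eqmodP/asboolP. Qed.

Lemma repr_wclassP s : word_cong (repr (wclass s)) s.
Proof. by apply/wclass_eqP; exact: reprK. Qed.

Lemma wclass_surj (x : word_group) : exists s, x = wclass s.
Proof. by exists (repr x); rewrite /wclass reprK. Qed.

Definition wmul (x y : word_group) : word_group := wclass (repr x ++ repr y).
Definition wone : word_group := wclass [::].
Definition winv (x : word_group) : word_group := wclass (rev (repr x)).

Lemma wmul_class s t : wmul (wclass s) (wclass t) = wclass (s ++ t).
Proof. by apply/wclass_eqP; apply: word_cong_cat; apply: repr_wclassP. Qed.

Lemma winv_class s : winv (wclass s) = wclass (rev s).
Proof. by apply/wclass_eqP/word_cong_rev/repr_wclassP. Qed.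

Lemma wmulA : associative wmul.
Proof.
move=> x y z; have [s ->] := wclass_surj x; have [t ->] := wclass_surj y.
by have [v ->] := wclass_surj z; rewrite !wmul_class catA.
Qed.

Lemma wmul1g : left_id wone wmul.
Proof. by move=> x; have [s ->] := wclass_surj x; rewrite wmul_class. Qed.

Lemma wmulg1 : right_id wone wmul.
Proof. by move=> x; have [s ->] := wclass_surj x; rewrite wmul_class cats0. Qed.

Lemma wmulVg : left_inverse wone winv wmul.
Proof.
move=> x; have [s ->] := wclass_surj x; rewrite winv_class wmul_class.
exact/wclass_eqP/word_cong_rev_cat.
Qed.

Lemma wmulgV : right_inverse wone winv wmul.
Proof.
move=> x; have [s ->] := wclass_surj x; rewrite winv_class wmul_class.
exact/wclass_eqP/word_cong_cat_rev.
Qed.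

HB.instance Definition _ :=
  isGroup.Build word_group wmulA wmul1g wmulg1 wmulVg wmulgV.

Definition word_gen (i : 'I_N) : word_group := wclass [:: i].

End Presented.

Definition no_rel (s t : seq 'I_N) : Prop := False.

Definition half_comm_rel (s t : seq 'I_N) : Prop :=
  exists a b c : 'I_N, s = [:: a; b; c] /\ t = [:: c; b; a].

Definition Z2free : groupType := word_group no_rel.
Definition Z2free_gen : 'I_N -> Z2free := @word_gen no_rel.

Definition Z2half : groupType := word_group half_comm_rel.
Definition Z2half_gen : 'I_N -> Z2half := @word_gen half_comm_rel.

End Z2Products.

(* Main.v *)
(* Let u be the fundamental matrix of a quantum group H acting on a cube with
   symmetries g_1, ..., g_N. Substituting for g_p commuting copies of symmetries in
   any C*-algebra that satisfy the relations of the cube, the elements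
   v_i = sum_p u_ip g_p again satisfy these relations. Take for g_p the permutation
   matrices of involutions of a finite set, with values in M_n(C(H)): the matrix
   entries of products of the v_i are sums of products of the u_ip over paths in
   that set. Reflections x |-> d_p - x of Z/12 with suitable weights d_p isolate
   one or two products (free and half-liberated cubes), and so do two commuting
   reflections of Z/8 for the classical cube. With the antipode, which
   exchanges rows and columns, this gives all the relations of H_N^+, H_N^* and
   \bar O_N. Conversely, these relations are inherited by the v_i, and by coproduct,
   counit and antipode.

   That M_n(A) is a C*-algebra comes from its action on the Hilbert module A^n, and
   maximal tensor products are universal C*-algebras, which exist since *-morphisms
   are contractive. Both only need square roots and the positivity of x^* x, for
   which no spectral theory is used. *)
Require Import Defs.
From HB Require Import structures.
From mathcomp Require Import all_boot all_order all_algebra all_fingroup.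
From mathcomp Require Import generic_quotient complex ring lra.
From mathcomp Require Import all_classical all_reals.

Set Implicit Arguments.
Unset Strict Implicit.
Unset Printing Implicit Defensive.

Import Order.TTheory GRing.Theory Num.Theory.

Local Open Scope classical_set_scope.
Local Open Scope ring_scope.

(** Comparing coefficients inside the tensor product of C(H) with the group algebra would require
    the linear independence of the group elements there. Finite permutation matrices reduce this to
    reading matrix entries, and maximality of the tensor product is what permits the substitution in
    any algebra. For the half-liberated cube, the words abc and cba are equal in the group, so every
    substitution isolates a sum of two products; these are separated afterwards by multiplication by
    u_ia^2, which the row and column relations make possible. For the classical cube the words ab
    and ba merge in the same way, and the antipode separates them. Since algebras are nonzero by
    definition, a maximal tensor product exists only if some pair of commuting representations does:
    the counit, a character, supplies one. The universal algebra is a completion of formal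
    polynomials and needs norm bounds that are uniform in all representations; for tensor products
    they come from contractivity. *)

Local Notation "x %:C" := (real_complex _ x) (format "x %:C") : ring_scope.
Local Notation "x ^c" := (star x) : ring_scope.

(** * Norm and limits in a C*-algebra *)

Section CStarBasics.
Variables (R : realType) (A : cstarAlgType R).
Implicit Types (a b x y z : A) (u v : nat -> A).

Lemma star0 : (0 : A)^c = 0.
Proof. by apply: (addIr ((0 : A)^c)); rewrite -starD !add0r. Qed.

Lemma starN a : (- a)^c = - a^c.
Proof. by apply: (addIr (a^c)); rewrite -starD !addNr star0. Qed.

Lemma starB a b : (a - b)^c = a^c - b^c.
Proof. by rewrite starD starN. Qed.

Lemma star1 : (1 : A)^c = 1.
Proof. by rewrite -[LHS]mulr1 -{2}[1]starK -starM mulr1 starK. Qed.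

Lemma starX a n : (a ^+ n)^c = (a^c) ^+ n.
Proof. by elim: n => [|n IH]; rewrite ?expr0 ?star1// exprS exprSr starM IH. Qed.

Lemma star_sum (I : Type) (r : seq I) (P : pred I) (F : I -> A) :
  (\sum_(i <- r | P i) F i)^c = \sum_(i <- r | P i) (F i)^c.
Proof. exact: (big_morph _ starD star0). Qed.

Lemma conj_real (r : R) : (r%:C)^* = r%:C :> R[i].
Proof. exact: conjc_real. Qed.

Lemma starZr (r : R) a : (r%:C *: a)^c = r%:C *: a^c.
Proof. by rewrite starZ conj_real. Qed.

Lemma cnormZr (r : R) a : cnorm (r%:C *: a) = `|r| * cnorm a.
Proof.
apply: (@complexI R); rewrite cnormZ rmorphM/=; congr (_ * _).
by rewrite normc_def/= expr0n/= addr0 sqrtr_sqr.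
Qed.

Lemma cnorm0 : cnorm (0 : A) = 0.
Proof. by rewrite -(scale0r (0 : A)) -[0]/((0 : R)%:C) cnormZr normr0 mul0r. Qed.

Lemma cnormN a : cnorm (- a) = cnorm a.
Proof.
by rewrite -scaleN1r -[1]/((1 : R)%:C) -rmorphN cnormZr normrN normr1 mul1r.
Qed.

Lemma cnorm_ge0 a : 0 <= cnorm a.
Proof.
have := cnormD a (- a); rewrite subrr cnorm0 cnormN => h.
by rewrite -(pmulrn_lge0 _ (isT : (0 < 2)%N)) mulr2n.
Qed.

Lemma cnormBC a b : cnorm (a - b) = cnorm (b - a).
Proof. by rewrite -cnormN opprB. Qed.

Lemma cnormB a b : cnorm (a - b) <= cnorm a + cnorm b.
Proof. by rewrite -(cnormN b) cnormD. Qed.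

Lemma cnorm_triangle b a c : cnorm (a - c) <= cnorm (a - b) + cnorm (b - c).
Proof. by rewrite -(subrKA b a (- c)) cnormD. Qed.

Lemma cnorm_le0 a : cnorm a <= 0 -> a = 0.
Proof. by move=> h; apply: cnorm_eq0; apply/eqP; rewrite eq_le h cnorm_ge0. Qed.

Lemma cnorm_star a : cnorm a^c = cnorm a.
Proof.
have le b : cnorm b <= cnorm b^c.
  have := cnormM b^c b; rewrite cnorm_starM expr2.
  have [->|b0] := eqVneq (cnorm b) 0; first by rewrite cnorm_ge0.
  by rewrite ler_pM2r// lt_def b0 cnorm_ge0.
by apply/eqP; rewrite eq_le le -{2}(starK a) le.
Qed.

Lemma cnorm1 : cnorm (1 : A) = 1.
Proof.
have := cnorm_starM (1 : A); rewrite star1 mul1r expr2 => e.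
have n0 : cnorm (1 : A) != 0.
  by apply/eqP => /cnorm_eq0/eqP; rewrite oner_eq0.
by apply: (mulfI n0); rewrite -e mulr1.
Qed.

Lemma cnorm_self a : a^c = a -> cnorm (a * a) = cnorm a ^+ 2.
Proof. by move=> e; rewrite -{1}e cnorm_starM. Qed.

Lemma cnorm_sum (I : Type) (r : seq I) (P : pred I) (F : I -> A) :
  cnorm (\sum_(i <- r | P i) F i) <= \sum_(i <- r | P i) cnorm (F i).
Proof.
elim/big_rec2: _ => [|i x y _ h]; first by rewrite cnorm0.
by apply: le_trans (cnormD _ _) _; rewrite lerD2l.
Qed.

Definition clim u a := forall e : R, 0 < e ->
  exists n, forall p, (n <= p)%N -> cnorm (u p - a) < e.

Lemma clim_cst a : clim (fun=> a) a.
Proof. by move=> e e0; exists 0%N => p _; rewrite subrr cnorm0. Qed.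

Lemma clim_unique u a b : clim u a -> clim u b -> a = b.
Proof.
move=> ua ub; apply/eqP; rewrite -subr_eq0; apply/eqP/cnorm_le0.
apply/ler_addgt0Pr => e e0; rewrite add0r.
have e2 : 0 < e / 2 by rewrite divr_gt0.
have [n hn] := ua _ e2; have [m hm] := ub _ e2.
have := hn _ (leq_maxl n m); have := hm _ (leq_maxr n m).
set p := maxn n m => h1 h2.
by have := cnorm_triangle (u p) a b; rewrite (cnormBC a (u p)) => h; lra.
Qed.

Lemma climD u v a b : clim u a -> clim v b -> clim (fun n => u n + v n) (a + b).
Proof.
move=> ua vb e e0; have e2 : 0 < e / 2 by rewrite divr_gt0.
have [n hn] := ua _ e2; have [m hm] := vb _ e2.
exists (maxn n m) => p; rewrite geq_max => /andP[/hn h1 /hm h2].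
rewrite opprD addrACA; have := cnormD (u p - a) (v p - b).
by move=> h; lra.
Qed.

Lemma clim_le (k : R) u v a b : (forall n, cnorm (v n - b) <= k * cnorm (u n - a)) ->
  clim u a -> clim v b.
Proof.
move=> le ua e e0; have k1 : 0 < `|k| + 1 by rewrite ltr_wpDl.
have [n hn] := ua _ (divr_gt0 e0 k1); exists n => p /hn; rewrite ltr_pdivlMr// => h.
apply: le_lt_trans (le _) _; apply: le_lt_trans h; rewrite mulrC.
by rewrite ler_wpM2l ?cnorm_ge0// (le_trans (ler_norm _))// lerDl.
Qed.

Lemma climMl c u a : clim u a -> clim (fun n => c * u n) (c * a).
Proof. by apply: (@clim_le (cnorm c)) => n; rewrite -mulrBr cnormM. Qed.

Lemma climMr c u a : clim u a -> clim (fun n => u n * c) (a * c).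
Proof.
by apply: (@clim_le (cnorm c)) => n; rewrite -mulrBl mulrC cnormM.
Qed.

Lemma climZ c u a : clim u a -> clim (fun n => c *: u n) (c *: a).
Proof.
by rewrite -(mulr_algl c a) => /(climMl c%:A); under eq_fun do rewrite mulr_algl.
Qed.

Lemma clim_star u a : clim u a -> clim (fun n => (u n)^c) a^c.
Proof. by apply: (@clim_le 1) => n; rewrite -starB cnorm_star mul1r. Qed.

Lemma eq_clim u v a : (forall n, u n = v n) -> clim u a -> clim v a.
Proof. by move=> /funext ->. Qed.

Lemma climM u v a b : clim u a -> clim v b -> clim (fun n => u n * v n) (a * b).
Proof.
move=> ua vb; pose w n := u n - a; pose z n := v n - b.
have w0 : clim w 0 by rewrite -(subrr a); apply: climD ua (clim_cst _).
have z0 : clim z 0 by rewrite -(subrr b); apply: climD vb (clim_cst _).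
apply: (@eq_clim (fun n => w n * z n + w n * b + (a * z n + a * b))).
  by move=> n; rewrite -mulrDr -mulrDr -mulrDl !subrK.
have e1 : a * b = 0 + 0 * b + (a * 0 + a * b) by rewrite mul0r mulr0 !add0r.
rewrite [X in clim _ X]e1.
apply: climD; last exact: climD (climMl a z0) (clim_cst _).
apply: climD; last exact: climMr w0.
move=> e e0; have [n hn] := w0 _ e0; have [m hm] := z0 _ ltr01.
exists (maxn n m) => p; rewrite geq_max => /andP[/hn h1 /hm h2].
move: h1 h2; rewrite !subr0 => h1 h2; apply: le_lt_trans (cnormM _ _) _.
by apply: le_lt_trans h1; rewrite ler_piMr ?cnorm_ge0// ltW.
Qed.

Lemma clim_norm_le (K : R) u a : (forall n, cnorm (u n) <= K) -> clim u a ->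
  cnorm a <= K.
Proof.
move=> uK ua; apply/ler_addgt0Pr => e /ua[n /(_ n (leqnn n)) h].
have := cnormD (u n) (a - u n); rewrite subrKC (cnormBC a) => h'.
by have := uK n; lra.
Qed.

End CStarBasics.

(** * Square roots and positivity *)

Section SquareRoot.
Variable R : realType.

(* The binomial series of [1 - sqrt (1 - x)] has nonnegative coefficients, and
   so have the differences of consecutive iterates of [y |-> (x + y^2) / 2].
   Hence, for [|x| <= 1], they are dominated by those of the iteration at 1. *)
Fixpoint half_iter (n : nat) : R :=
  if n is m.+1 then (1 + half_iter m ^+ 2) / 2 else 0.

Lemma half_iter_itv n : 0 <= half_iter n <= 1.
Proof.
elim: n => [|n /andP[h0 h1]] /=; first by rewrite lexx ler01.
by apply/andP; split; nra.
Qed.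

Lemma half_iter_cauchy (e : R) : 0 < e ->
  exists n, forall p, (n <= p)%N -> half_iter p - half_iter n < e.
Proof.
move=> e0; have hs : has_sup (range half_iter).
  by split; [exists 0, 0%N|exists 1 => _ [n _ <-]; have /andP[] := half_iter_itv n].
have [_ [n _ <-] h] := sup_adherent e0 hs; exists n => p _.
have : half_iter p <= sup (range half_iter).
  by apply: ub_le_sup; [case: hs|exists p].
by lra.
Qed.

Variable A : cstarAlgType R.
Implicit Types (a b x y z : A).

Fixpoint sqrt_iter x n : A :=
  if n is m.+1 then (2^-1 : R)%:C *: (x + sqrt_iter x m ^+ 2) else 0.

Lemma sqrt_iterS x n : sqrt_iter x n.+1 = (2^-1 : R)%:C *: (x + sqrt_iter x n ^+ 2).
Proof. by []. Qed.

Lemma sqrt_iter_norm x n : cnorm x <= 1 -> cnorm (sqrt_iter x n) <= half_iter n.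
Proof.
move=> x1; elim: n => [|n IH] /=; first by rewrite cnorm0.
rewrite cnormZr gtr0_norm ?invr_gt0// mulrC ler_wpM2r ?invr_ge0//.
apply: le_trans (cnormD _ _) (lerD x1 _); rewrite !expr2.
by apply: le_trans (cnormM _ _) _; rewrite ler_pM// cnorm_ge0.
Qed.

(** The difference of two squares factors without commutativity as a (a - b) + (a - b) b, and each
    factor is dominated by its counterpart in the scalar iteration at 1. *)
Lemma sqrt_iter_step x n : cnorm x <= 1 ->
  cnorm (sqrt_iter x n.+1 - sqrt_iter x n) <= half_iter n.+1 - half_iter n.
Proof.
move=> x1; elim: n => [|n].
  rewrite /= expr2 mulr0 addr0 subr0 cnormZr gtr0_norm ?invr_gt0//.
  by rewrite expr0n addr0 subr0 mul1r ler_piMr ?invr_ge0.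
have := sqrt_iter_norm n.+1 x1; have := sqrt_iter_norm n x1.
set a := sqrt_iter x n.+1; set b := sqrt_iter x n.
set s := half_iter n.+1; set t := half_iter n => hb ha IH.
have -> : sqrt_iter x n.+2 - a = (2^-1 : R)%:C *: (a ^+ 2 - b ^+ 2).
  by rewrite /a !sqrt_iterS -scalerBr opprD addrACA subrr add0r.
have -> : half_iter n.+2 - s = 2^-1 * (s ^+ 2 - t ^+ 2).
  by rewrite /s /t /=; field.
rewrite cnormZr gtr0_norm ?invr_gt0//.
have -> : a ^+ 2 - b ^+ 2 = a * (a - b) + (a - b) * b.
  by rewrite mulrBr mulrBl subrKA.
have := cnormD (a * (a - b)) ((a - b) * b).
have := cnormM a (a - b); have := cnormM (a - b) b.
have := cnorm_ge0 a; have := cnorm_ge0 b; have := cnorm_ge0 (a - b).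
set d := cnorm (a - b) in IH *; move=> d0 b0 a0 h1 h2 h3.
have : cnorm a * d <= s * (s - t) by rewrite ler_pM.
have : d * cnorm b <= (s - t) * t by rewrite ler_pM.
by lra.
Qed.

Lemma sqrt_iter_dist x m n : cnorm x <= 1 -> (m <= n)%N ->
  cnorm (sqrt_iter x n - sqrt_iter x m) <= half_iter n - half_iter m.
Proof.
move=> x1 /subnK <-; elim: (n - m)%N => [|k IH]; first by rewrite !subrr cnorm0.
rewrite addSn; have := sqrt_iter_step (k + m) x1.
have := cnorm_triangle (sqrt_iter x (k + m)) (sqrt_iter x (k + m).+1) (sqrt_iter x m).
by lra.
Qed.

Lemma sqrt_iter_cvg x : exists y, cnorm x <= 1 -> clim (sqrt_iter x) y.
Proof.
have [x1|] := boolP (cnorm x <= 1); last by exists 0.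
have [|y hy] := cnorm_complete (sqrt_iter x); last by exists y.
move=> e e0; have e2 : 0 < e / 2 by rewrite divr_gt0.
have [n hn] := half_iter_cauchy e2; exists n => p q np nq.
have := cnorm_triangle (sqrt_iter x n) (sqrt_iter x p) (sqrt_iter x q).
rewrite (cnormBC (sqrt_iter x n)) => h.
have := sqrt_iter_dist x1 np; have := sqrt_iter_dist x1 nq.
by have := hn _ np; have := hn _ nq; lra.
Qed.

(** A square root of 1 - x on the unit ball: the limit y of the iteration satisfies 2 y = x + y^2.
    The conditional form of [sqrt_iter_cvg] makes this a total function, with an arbitrary value
    elsewhere. *)
Definition csqrt1B x : A := 1 - projT1 (cid (sqrt_iter_cvg x)).

Lemma csqrt1B_cvg x : cnorm x <= 1 -> clim (sqrt_iter x) (1 - csqrt1B x).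
Proof. by rewrite /csqrt1B opprB addrC subrK; case: cid. Qed.

(** Yields the positivity of the root in the sense of [cpos], with t = 1. *)
Lemma csqrt1B_dist x : cnorm x <= 1 -> cnorm (1 - csqrt1B x) <= 1.
Proof.
move=> x1; apply: clim_norm_le (csqrt1B_cvg x1) => n.
by apply: le_trans (sqrt_iter_norm n x1) _; have /andP[] := half_iter_itv n.
Qed.

Lemma csqrt1B_sq x : cnorm x <= 1 -> csqrt1B x ^+ 2 = 1 - x.
Proof.
move=> x1; have [y hy ->] : exists2 y, clim (sqrt_iter x) y & csqrt1B x = 1 - y.
  exists (1 - csqrt1B x); first exact: csqrt1B_cvg.
  by rewrite opprB addrC subrK.
have e : y = (2^-1 : R)%:C *: (x + y ^+ 2).
  apply: (@clim_unique _ _ (fun n => sqrt_iter x n.+1)).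
    by move=> r /hy[n hn]; exists n => p np; exact: hn _ (leqW np).
  exact: climZ (climD (clim_cst x) (climM hy hy)).
have {}e : y + y = x + y ^+ 2.
  rewrite {1 2}e -scalerDl -rmorphD (_ : 2^-1 + 2^-1 = 1 :> R); first by rewrite scale1r.
  by field.
have -> : (1 - y) ^+ 2 = 1 - (y + y) + y ^+ 2.
  by rewrite expr2 mulrBl mul1r mulrBr mulr1 -expr2 opprB opprD !addrA addrAC.
by rewrite e opprD addrA subrK.
Qed.

Lemma csqrt1B_star x : cnorm x <= 1 -> x^c = x -> (csqrt1B x)^c = csqrt1B x.
Proof.
move=> x1 xs; have hy := csqrt1B_cvg x1; apply: oppr_inj; apply: (addrI 1).
rewrite -{1}(star1 A) -starN -starD; 
  apply: (@clim_unique _ _ (sqrt_iter x)); last exact: hy.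
apply: eq_clim (clim_star hy) => n; elim: n => [|n IH] /=; first exact: star0.
by rewrite starZr starD starX xs IH.
Qed.

Lemma csqrt1B_comm x z : cnorm x <= 1 -> x * z = z * x ->
  csqrt1B x * z = z * csqrt1B x.
Proof.
move=> x1 xz; have hy := csqrt1B_cvg x1.
have e : (1 - csqrt1B x) * z = z * (1 - csqrt1B x).
  apply: clim_unique (climMr z hy) _; apply: eq_clim (climMl z hy) => n.
  elim: n => [|n IH] /=; first by rewrite mulr0 mul0r.
  rewrite -scalerAr -scalerAl mulrDl mulrDr xz; congr (_ *: (_ + _)).
  by rewrite !expr2 -mulrA -IH !mulrA IH.
by move: e; rewrite mulrBl mulrBr mul1r mulr1 => /addrI/oppr_inj.
Qed.

End SquareRoot.

(** The bound for c^-1 at the vector c x is the reverse inequality. Norms defined as an infimum or a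
    supremum then only need the upper estimate. *)
Lemma complex_homogeneous (R : realType) (V : lmodType R[i]) (F : V -> R) :
  (forall x, 0 <= F x) -> (forall c x, F (c *: x) <= complex.Re `|c| * F x) ->
  forall c x, (F (c *: x))%:C = `|c| * (F x)%:C.
Proof.
move=> F0 le c x; have cR (d : R[i]) : `|d| = (complex.Re `|d|)%:C by rewrite normc_def.
have [->|c_n0] := eqVneq c 0.
  rewrite scale0r normr0 mul0r; congr _%:C; apply/eqP.
  by rewrite eq_le F0 andbT -(scale0r (0 : V)) (le_trans (le _ _))// normr0 mul0r.
rewrite [in RHS]cR -rmorphM; congr _%:C; apply/eqP; rewrite eq_le le/=.
have := le c^-1 (c *: x); rewrite scalerA mulVf// scale1r => h.
have cp : 0 < complex.Re `|c|.
  by rewrite lt_def -ler0c -cR normr_ge0 andbT -(inj_eq (@complexI R)) -cR normr_eq0.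
by rewrite -ler_pdivlMl// (le_trans h)// normfV {1}cR -fmorphV.
Qed.

Section Positivity.
Variables (R : realType) (A : cstarAlgType R).
Implicit Types (a b c e g h x y z : A).

Lemma starZi a : ('i *: a)^c = - ('i *: a^c).
Proof. by rewrite starZ conjCi scaleNr. Qed.

(* The element [e + i g] is a multiple of a unitary. *)
Lemma cnorm_le_sumsq (t : R) e g : 0 <= t -> e^c = e -> g^c = g -> e * g = g * e ->
  e ^+ 2 + g ^+ 2 = t%:C%:A -> cnorm e ^+ 2 <= t.
Proof.
move=> t0 es gs eg sq; pose z := e + 'i *: g.
have zs : z^c = e - 'i *: g by rewrite starD starZi es gs.
have zz : z^c * z = t%:C%:A.
  rewrite zs /z mulrDr !mulrBl -sq !expr2 -!scalerAl -!scalerAr eg subrKA.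
  by rewrite scalerA -['i * 'i]expr2 sqrCi scaleN1r opprK.
have : cnorm z ^+ 2 = t.
  by rewrite -cnorm_starM zz cnormZr cnorm1 mulr1 ger0_norm.
have : cnorm e <= cnorm z.
  have -> : e = (2^-1 : R)%:C *: (z + z^c).
    rewrite zs addrACA subrr addr0 -mulr2n -scaler_nat scalerA.
    rewrite (_ : (2^-1 : R)%:C * 2%:R = 1) ?scale1r//.
    have -> : 2%:R = (2%:R : R)%:C :> R[i] by rewrite rmorph_nat.
    by rewrite -rmorphM mulVf ?pnatr_eq0.
  rewrite cnormZr gtr0_norm ?invr_gt0// mulrC ler_pdivrMr// mulr_natr mulr2n.
  by apply: le_trans (cnormD _ _) _; rewrite cnorm_star.
by move=> le <-; rewrite ler_pXn2r// nnegrE cnorm_ge0.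
Qed.

(* That is, the spectrum of [a] lies in the interval from 0 to [2 t]. *)
Definition cpos a := a^c = a /\ exists2 t : R, 0 < t & cnorm (t%:C%:A - a) <= t.

Lemma starA (t : R) : (t%:C%:A : A)^c = t%:C%:A.
Proof. by rewrite starZr star1. Qed.

Lemma cposD a b : cpos a -> cpos b -> cpos (a + b).
Proof.
move=> [sa [t t0 ha]] [sb [s s0 hb]]; split; first by rewrite starD sa sb.
exists (t + s); first exact: addr_gt0.
rewrite rmorphD scalerDl opprD addrACA.
by apply: le_trans (cnormD _ _) _; rewrite lerD.
Qed.

Lemma cpos0 : cpos 0.
Proof.
split; first exact: star0.
by exists 1 => //; rewrite subr0 cnormZr normr1 mul1r cnorm1.
Qed.

Lemma cpos_sum (I : Type) (r : seq I) (P : pred I) (F : I -> A) :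
  (forall i, cpos (F i)) -> cpos (\sum_(i <- r | P i) F i).
Proof. by move=> h; elim/big_rec: _ => [|i x _ px]; [exact: cpos0|exact: cposD]. Qed.

Lemma cposZ (r : R) a : 0 <= r -> cpos a -> cpos (r%:C *: a).
Proof.
rewrite le_eqVlt => /predU1P[<-|r0] [sa [t t0 ha]].
  by rewrite scale0r; exact: cpos0.
split; first by rewrite starZr sa.
exists (r * t); first exact: mulr_gt0.
by rewrite rmorphM -scalerA -scalerBr cnormZr gtr0_norm// ler_pM2l.
Qed.

Lemma cpos_dist (t : R) a : a^c = a -> cnorm a <= t -> cpos (t%:C%:A - a).
Proof.
move=> sa at_; have t0 : 0 <= t := le_trans (cnorm_ge0 a) at_.
split; first by rewrite starB starA sa.
exists (t + 1); first by rewrite ltr_wpDl.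
rewrite rmorphD scalerDl opprB (addrC t%:C%:A) addrACA subrr addr0.
rewrite (le_trans (cnormD _ _))// cnormZr normr1 mul1r cnorm1 addrC lerD2r//.
Qed.

(** Division by the t of [cpos] writes a as t (1 - x) with x in the unit ball. The last clause
    stands in for functional calculus: it lets roots of commuting elements commute. *)
Lemma cpos_sqrt a : cpos a -> exists h, [/\ cpos h, a = h ^+ 2 &
  forall z, a * z = z * a -> h * z = z * h].
Proof.
move=> [sa [t t0 ha]]; pose x : A := 1 - (t^-1)%:C *: a.
have x1 : cnorm x <= 1.
  have -> : x = (t^-1)%:C *: (t%:C%:A - a).
    by rewrite scalerBr scalerA -rmorphM mulVf ?gt_eqF// scale1r.
  by rewrite cnormZr gtr0_norm ?invr_gt0// mulrC ler_pdivrMr// mul1r.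
have xs : x^c = x by rewrite starB star1 starZr sa.
exists ((Num.sqrt t)%:C *: csqrt1B x); split.
- apply: cposZ (sqrtr_ge0 _) _; split; first exact: csqrt1B_star.
  by exists 1 => //; rewrite rmorph1 scale1r csqrt1B_dist.
- rewrite exprZn csqrt1B_sq// /x opprB addrC subrK scalerA -rmorphXn -rmorphM.
  by rewrite sqr_sqrtr ?ltW// mulfV ?gt_eqF// scale1r.
- move=> z az; rewrite -scalerAl -scalerAr csqrt1B_comm//.
  by rewrite /x mulrBl mulrBr mul1r mulr1 -scalerAl -scalerAr az.
Qed.

(** Once h is scaled to k in the unit ball, s = sqrt (1 - k^2) commutes with k and s^2 + k^2 = 1,
    whence |1 - k^2| = |s|^2 <= 1. The scale |h| + 1 is positive even for h = 0. *)
Lemma cpos_sq h : h^c = h -> cpos (h ^+ 2).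
Proof.
move=> hs; pose t := cnorm h + 1; have t0 : 0 < t by rewrite ltr_wpDl ?cnorm_ge0.
pose k := (t^-1)%:C *: h; have ks : k^c = k by rewrite starZr hs.
have -> : h ^+ 2 = (t ^+ 2)%:C *: k ^+ 2.
  by rewrite exprZn scalerA -rmorphXn -rmorphM exprVn mulfV ?scale1r// expf_neq0// gt_eqF.
apply: cposZ (exprn_ge0 _ (ltW t0)) _.
have k1 : cnorm (k ^+ 2) <= 1.
  rewrite expr2 cnorm_self// cnormZr gtr0_norm ?invr_gt0// expr_le1//.
    by rewrite mulrC ler_pdivrMr// mul1r lerDl.
  by rewrite mulr_ge0 ?cnorm_ge0// invr_ge0 ltW.
have k2s : (k ^+ 2)^c = k ^+ 2 by rewrite starX ks.
split=> //; exists 1 => //; rewrite rmorph1 scale1r -csqrt1B_sq//.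
set s := csqrt1B _; have ss : s^c = s := csqrt1B_star k1 k2s.
rewrite expr2 cnorm_self//; apply: (@cnorm_le_sumsq 1 s k) => //.
  by rewrite csqrt1B_comm// -exprS -exprSr.
by rewrite csqrt1B_sq// subrK rmorph1 scale1r.
Qed.

(** As b = t - a, the square roots of a and b commute, and [cnorm_le_sumsq] bounds the root of a. *)
Lemma cpos_le_scalar (t : R) a b : 0 <= t -> cpos a -> cpos b -> a + b = t%:C%:A ->
  cnorm a <= t.
Proof.
move=> t0 pa pb ab; have [h [[hs _] ah hc]] := cpos_sqrt pa.
have [k [[ks _] bk kc]] := cpos_sqrt pb.
have b_eq : b = t%:C%:A - a by rewrite -ab addrC addKr.
have hk : h * k = k * h.
  apply: hc; apply/esym/kc; rewrite b_eq mulrBl mulrBr.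
  by rewrite -scalerAl -scalerAr mul1r mulr1.
rewrite ah expr2 cnorm_self//; apply: cnorm_le_sumsq t0 hs ks hk _.
by rewrite -ah -bk.
Qed.

(** Adding the positive element |a + b| - (a + b) to b makes the total a scalar. *)
Lemma cnorm_le_cposD a b : cpos a -> cpos b -> cnorm a <= cnorm (a + b).
Proof.
move=> pa pb; have sab : (a + b)^c = a + b by case: (cposD pa pb).
have pab := cpos_dist sab (lexx _).
apply: (cpos_le_scalar (cnorm_ge0 _) pa (cposD pab pb)).
by rewrite addrCA subrK.
Qed.

Lemma cpos_antisym a : cpos a -> cpos (- a) -> a = 0.
Proof.
by move=> pa pa'; apply: cnorm_le0; rewrite -(cnorm0 A) -(subrr a) cnorm_le_cposD.
Qed.

(** Up to sign, e and g are twice the real and imaginary parts of z; in e^2 + g^2 the squares of z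
    and of [star z] cancel. *)
Lemma cpos_starMD z : cpos (z^c * z + z * z^c).
Proof.
pose e := z + z^c; pose g := 'i *: (z - z^c).
have es : e^c = e by rewrite starD starK addrC.
have gs : g^c = g by rewrite starZi starB starK -scalerN opprB.
have -> : z^c * z + z * z^c = (2^-1 : R)%:C *: (e ^+ 2 + g ^+ 2).
  have -> : e ^+ 2 + g ^+ 2 = 2%:R *: (z^c * z + z * z^c).
    rewrite exprZn sqrCi scaleN1r !expr2 mulrDl mulrBl opprD opprK addrACA.
    rewrite -mulrBr -mulrDr scaler_nat opprB /e (addrC z z^c).
    rewrite addrACA subrr addr0 (addrC _ (z - z^c)) subrKA.
    by rewrite !mulrDr -!mulr2n addrC mulrnDl.
  rewrite scalerA (_ : _ * 2%:R = 1) ?scale1r//.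
  have -> : 2%:R = (2%:R : R)%:C :> R[i] by rewrite rmorph_nat.
  by rewrite -rmorphM mulVf ?pnatr_eq0.
by apply: cposZ; [rewrite invr_ge0|exact: cposD (cpos_sq es) (cpos_sq gs)].
Qed.

(* With [p = - z^* z = r^2] and [q = z z^*], the element [s = z r] satisfies
   [s^* s + s s^* = - (p^2 + q^2)]. *)
Lemma cpos_oppstarM z : cpos (- (z^c * z)) -> z = 0.
Proof.
set p := - (z^c * z); set q := z * z^c => pp.
have ps : p^c = p by rewrite starN starM starK.
have qs : q^c = q by rewrite starM starK.
have [r [[rs _] pr _]] := cpos_sqrt pp.
pose s := z * r.
have e1 : s^c * s = - p ^+ 2.
  rewrite starM rs -mulrA (mulrA _ z) -[z^c * z]opprK -/p mulNr mulrN pr.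
  by rewrite -exprSr -exprS -exprM.
have e2 : s * s^c = - q ^+ 2.
  rewrite starM rs -mulrA (mulrA r) -expr2 -pr /p mulNr mulrN; congr (- _).
  by rewrite expr2 /q !mulrA.
have := cpos_starMD s; rewrite e1 e2 -opprD => neg.
have p2 := cpos_sq ps; have q2 := cpos_sq qs.
have pq0 := cpos_antisym (cposD p2 q2) neg.
have : cnorm (p ^+ 2) <= 0 by rewrite -(cnorm0 A) -pq0 cnorm_le_cposD.
rewrite expr2 cnorm_self// cnormN cnorm_starM -exprM => h.
apply: cnorm_eq0; apply/eqP; have : cnorm z ^+ (2 * 2) == 0.
  by rewrite eq_le h exprn_ge0 ?cnorm_ge0.
by rewrite expf_eq0.
Qed.

(* With [h] the square root of [y^2] and [w = h - y] twice the negative part of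
   [y], one has [(x w)^* (x w) = w y w = - h w^2]. *)
Lemma cpos_starM x : cpos (x^c * x).
Proof.
set y := x^c * x; have ys : y^c = y by rewrite starM starK.
have [h [ph yh /(_ y)]] := cpos_sqrt (cpos_sq ys).
rewrite -exprS -exprSr => /(_ erefl) hy.
have [k [[ks _] hk /(_ y hy) ky]] := cpos_sqrt ph.
pose w := h - y; have ws : w^c = w by rewrite starB ys (proj1 ph).
have yw : y * w = - (h * w) by rewrite !mulrBr -expr2 yh -hy expr2 opprB.
have kw : k * w = w * k.
  by rewrite mulrBr mulrBl ky hk -exprS -exprSr.
have /cpos_oppstarM xw : cpos (- ((x * w)^c * (x * w))).
  have -> : - ((x * w)^c * (x * w)) = (k * w) ^+ 2.
    rewrite starM ws -mulrA (mulrA _ x) -/y yw mulrN opprK hk.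
    by rewrite !expr2 !mulrA -kw.
  by apply: cpos_sq; rewrite starM ws ks.
have hw : h * w = 0.
  by apply: oppr_inj; rewrite -yw oppr0 /y -mulrA xw mulr0.
have w0 : w = 0.
  have : cnorm (w * w) = 0.
    by rewrite {1}/w mulrBl yw hw oppr0 subr0 cnorm0.
  by rewrite cnorm_self// => /eqP; rewrite expf_eq0/= => /eqP/cnorm_eq0.
by have /eqP : w = 0 := w0; rewrite subr_eq0 => /eqP <-.
Qed.

Lemma cpos_conj a x : cpos a -> cpos (x^c * a * x).
Proof.
move=> /cpos_sqrt[h [[hs _] -> _]].
have -> : x^c * h ^+ 2 * x = (h * x)^c * (h * x); last exact: cpos_starM.
by rewrite starM hs expr2 !mulrA.
Qed.

End Positivity.

(** * Contractivity of morphisms that preserve the involution *)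

Section Contraction.
Variables (R : realType) (A B : cstarAlgType R) (f : {lrmorphism A -> B}).
Hypothesis fs : star_preserving f.

(* If [|b| <= 1] then [1 - b^2] is the square of a self-adjoint element, hence so
   is [1 - f(b)^2]. *)
Lemma cnorm_morph_le a : cnorm (f a) <= cnorm a.
Proof.
have self b : b^c = b -> cnorm b <= 1 -> cnorm (f b) <= 1.
  move=> bs b1; have b2 : cnorm (b ^+ 2) <= 1.
    by rewrite expr2 cnorm_self// expr_le1// cnorm_ge0.
  have b2s : (b ^+ 2)^c = b ^+ 2 by rewrite starX bs.
  rewrite -(@expr_le1 _ 2)// ?cnorm_ge0//.
  apply: (@cnorm_le_sumsq _ _ 1 _ (f (csqrt1B (b ^+ 2)))) => //.
  - by rewrite -fs bs.
  - by rewrite -fs csqrt1B_star.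
  - by rewrite -!rmorphM csqrt1B_comm// -exprS -exprSr.
  - by rewrite -!rmorphXn csqrt1B_sq// -rmorphD subrKC !rmorph1 scale1r.
have [->|a0] := eqVneq a 0; first by rewrite raddf0 !cnorm0.
have n0 : 0 < cnorm a.
  rewrite lt_def cnorm_ge0 andbT; apply: contra_neq a0; exact: cnorm_eq0.
rewrite -ler_sqr ?nnegrE ?cnorm_ge0// -!cnorm_starM -fs -rmorphM.
set b := a^c * a; have bs : b^c = b by rewrite starM starK.
have b0 : 0 < cnorm b by rewrite /b cnorm_starM exprn_gt0.
have := self ((cnorm b)^-1%:C *: b); rewrite starZr bs linearZ/= !cnormZr.
rewrite gtr0_norm ?invr_gt0// mulVf ?gt_eqF// => /(_ erefl (lexx _)).
by rewrite mulrC ler_pdivrMr// mul1r.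
Qed.

End Contraction.

(** * Matrices over a C*-algebra *)

Section HilbertModule.
Variables (R : realType) (A : cstarAlgType R) (n : nat).
Implicit Types (x y : 'cV[A]_n) (M : 'M[A]_n).

Definition cdot x y : A := \sum_i (x i 0)^c * y i 0.

Definition cvnorm x : R := Num.sqrt (cnorm (cdot x x)).

Definition adjmx M : 'M[A]_n := \matrix_(i, j) (M j i)^c.

Lemma cdotDl x y z : cdot (x + y) z = cdot x z + cdot y z.
Proof. by rewrite -big_split; apply: eq_bigr => i _; rewrite mxE starD mulrDl. Qed.

Lemma cdotDr x y z : cdot x (y + z) = cdot x y + cdot x z.
Proof. by rewrite -big_split; apply: eq_bigr => i _; rewrite mxE mulrDr. Qed.

Lemma cdotC x y : (cdot x y)^c = cdot y x.
Proof. by rewrite star_sum; apply: eq_bigr => i _; rewrite starM starK. Qed.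

(** A acts on columns from the right, so that [cdot] is A-linear in its second argument. *)
Definition crscale x (a : A) : 'cV[A]_n := \col_i (x i 0 * a).

Lemma cdotZr x y a : cdot x (crscale y a) = cdot x y * a.
Proof. by rewrite mulr_suml; apply: eq_bigr => i _; rewrite mxE mulrA. Qed.

Lemma cdotZl x y a : cdot (crscale x a) y = a^c * cdot x y.
Proof. by rewrite mulr_sumr; apply: eq_bigr => i _; rewrite mxE starM mulrA. Qed.

Lemma cdot_adj M x y : cdot x (M *m y) = cdot (adjmx M *m x) y.
Proof.
rewrite /cdot; under eq_bigr do rewrite mxE mulr_sumr.
rewrite exchange_big; apply: eq_bigr => j _; rewrite mxE star_sum mulr_suml.
by apply: eq_bigr => i _; rewrite !mxE starM starK mulrA.
Qed.

Lemma cdot_pos x : cpos (cdot x x).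
Proof. by apply: cpos_sum => i; exact: cpos_starM. Qed.

Lemma cvnorm_ge0 x : 0 <= cvnorm x. Proof. exact: sqrtr_ge0. Qed.

Lemma sqr_cvnorm x : cvnorm x ^+ 2 = cnorm (cdot x x).
Proof. by rewrite sqr_sqrtr ?cnorm_ge0. Qed.

Lemma cvnorm_entry x i : cnorm (x i 0) <= cvnorm x.
Proof.
rewrite -ler_sqr ?nnegrE ?cnorm_ge0 ?cvnorm_ge0// sqr_cvnorm -cnorm_starM.
rewrite /cdot (bigD1 i)//=; apply: cnorm_le_cposD; first exact: cpos_starM.
by apply: cpos_sum => j; exact: cpos_starM.
Qed.

Lemma cvnorm_le_sum x : cvnorm x <= \sum_i cnorm (x i 0).
Proof.
have s0 : 0 <= \sum_i cnorm (x i 0) by apply: sumr_ge0 => i _; exact: cnorm_ge0.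
rewrite -ler_sqr ?nnegrE ?cvnorm_ge0// sqr_cvnorm.
apply: le_trans (cnorm_sum _ _ _) _; rewrite expr2 mulr_suml; apply: ler_sum => i _.
rewrite cnorm_starM expr2 ler_wpM2l ?cnorm_ge0// (bigD1 i)//= lerDl.
by apply: sumr_ge0 => j _; exact: cnorm_ge0.
Qed.

(* For [t = |<x, x>|] and [a = <x, y>], the square of [t y - x a] expands to
   [t^2 <y, y> - t a^* a - (t a^* a - a^* <x, x> a)]. *)
Lemma cauchy_schwarz x y : cnorm (cdot x y) <= cvnorm x * cvnorm y.
Proof.
pose t := cnorm (cdot x x); have t0 : 0 <= t := cnorm_ge0 _.
have [t00|tn0] := eqVneq t 0.
  have -> : cdot x y = 0.
    rewrite /cdot big1// => i _; suff -> : x i 0 = 0 by rewrite star0 mul0r.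
    apply: cnorm_le0; apply: le_trans (cvnorm_entry x i) _.
    by rewrite /cvnorm -/t t00 sqrtr0.
  by rewrite cnorm0 mulr_ge0 ?cvnorm_ge0.
have {tn0} tp : 0 < t by rewrite lt_def tn0.
pose a := cdot x y; pose T := t%:C%:A : A.
have Ts : T^c = T by rewrite starA.
have TC b : b * T = T * b by rewrite -scalerAl -scalerAr mul1r mulr1.
pose e := crscale y T + crscale x (- a).
have ee : cdot e e = T * T * cdot y y - T * (a^c * a) - a^c * (T - cdot x x) * a.
  rewrite cdotDl !cdotDr !cdotZl !cdotZr Ts starN -(cdotC x y) -/a.
  rewrite !mulrN !mulNr opprK (TC (cdot y y)) mulrBr mulrBl opprB (TC a) !mulrA.
  by congr (_ + _); rewrite addrC.
have pos : cpos (T * (a^c * a)).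
  by rewrite -scalerAl mul1r; apply: cposZ => //; exact: cpos_starM.
have pos2 : cpos (cdot e e + a^c * (T - cdot x x) * a).
  by apply: cposD (cdot_pos e) (cpos_conj _ (cpos_dist _ _)); rewrite ?cdotC.
have := cnorm_le_cposD pos pos2; rewrite ee subrK addrC subrK.
rewrite -!scalerAl !mul1r !cnormZr ger0_norm// ler_pM2l// cnorm_starM => le.
rewrite -ler_sqr ?nnegrE ?mulr_ge0 ?cvnorm_ge0 ?cnorm_ge0// exprMn !sqr_cvnorm.
by move: le; rewrite -scalerAl mul1r cnormZr ger0_norm.
Qed.

Lemma cvnormD x y : cvnorm (x + y) <= cvnorm x + cvnorm y.
Proof.
rewrite -ler_sqr ?nnegrE ?addr_ge0 ?cvnorm_ge0// sqrrD !sqr_cvnorm.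
rewrite cdotDl !cdotDr; have := cauchy_schwarz x y; have := cauchy_schwarz y x.
have := cnormD (cdot x x + cdot x y) (cdot y x + cdot y y).
have := cnormD (cdot x x) (cdot x y); have := cnormD (cdot y x) (cdot y y).
by rewrite (mulrC (cvnorm y)) mulr2n; lra.
Qed.

(** Columns over A carry the scaling by A, so a complex scalar enters as [c%:A]. *)
Lemma cvnormZ c x : cvnorm (c%:A *: x) = complex.Re `|c| * cvnorm x.
Proof.
have cR : `|c| = (complex.Re `|c|)%:C by rewrite normc_def.
have c0 : 0 <= complex.Re `|c| by rewrite -ler0c -cR.
apply/eqP; rewrite -(@eqrXn2 _ 2)// ?cvnorm_ge0// ?mulr_ge0 ?cvnorm_ge0//.
rewrite exprMn !sqr_cvnorm.
have -> : cdot (c%:A *: x) (c%:A *: x) = (c^* * c) *: cdot x x.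
  rewrite scaler_sumr; apply: eq_bigr => i _; rewrite !mxE -!scalerAl !mul1r.
  by rewrite starZ -scalerAl -scalerAr scalerA.
apply/eqP/(@complexI R); rewrite cnormZ (mulrC c^*) -normCK normrX normr_id.
by rewrite rmorphM rmorphXn/= -cR.
Qed.

Definition mxbound M : R := \sum_i \sum_j cnorm (M i j).

Lemma mxbound_ge0 M : 0 <= mxbound M.
Proof. by do 2![apply: sumr_ge0 => ? _]; exact: cnorm_ge0. Qed.

Lemma mxboundP M x : cvnorm (M *m x) <= mxbound M * cvnorm x.
Proof.
apply: le_trans (cvnorm_le_sum _) _; rewrite mulr_suml; apply: ler_sum => i _.
rewrite mxE mulr_suml; apply: le_trans (cnorm_sum _ _ _) _; apply: ler_sum => j _.
apply: le_trans (cnormM _ _) _.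
by rewrite ler_wpM2l ?cnorm_ge0// cvnorm_entry.
Qed.

Definition mxopnorm M : R :=
  inf [set k : R | 0 <= k /\ forall x, cvnorm (M *m x) <= k * cvnorm x].

Lemma mxopnorm_has_inf M :
  has_inf [set k : R | 0 <= k /\ forall x, cvnorm (M *m x) <= k * cvnorm x].
Proof.
split; last by exists 0 => k [].
by exists (mxbound M); split; [exact: mxbound_ge0|exact: mxboundP].
Qed.

Lemma mxopnorm_le M k : 0 <= k -> (forall x, cvnorm (M *m x) <= k * cvnorm x) ->
  mxopnorm M <= k.
Proof. by move=> k0 h; apply: ge_inf => //; case: (mxopnorm_has_inf M). Qed.

Lemma mxopnorm_ge0 M : 0 <= mxopnorm M.
Proof. by apply: lb_le_inf => [|k []//]; case: (mxopnorm_has_inf M). Qed.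

Lemma mxopnormP M x : cvnorm (M *m x) <= mxopnorm M * cvnorm x.
Proof.
apply/ler_addgt0Pr => e e0; have d0 : 0 < cvnorm x + 1 by rewrite ltr_wpDl ?cvnorm_ge0.
have [k [k0 hk] ke] := inf_adherent (divr_gt0 e0 d0) (mxopnorm_has_inf M).
apply: le_trans (hk x) _.
apply: (@le_trans _ _ ((mxopnorm M + e / (cvnorm x + 1)) * cvnorm x)).
  by rewrite ler_wpM2r ?cvnorm_ge0// ltW.
rewrite mulrDl lerD2l mulrAC ler_pdivrMr// ler_pM2l// lerDl//.
Qed.

Lemma mxopnorm_le_bound M : mxopnorm M <= mxbound M.
Proof. by apply: mxopnorm_le; [exact: mxbound_ge0|exact: mxboundP]. Qed.

(** With [mxopnorm_le_bound], this squeezes the operator norm between the norm of each entry and the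
    sum of all of them: convergence is entrywise, and completeness follows from that of A. *)
Lemma mxopnorm_entry M i j : cnorm (M i j) <= mxopnorm M.
Proof.
pose e : 'cV[A]_n := delta_mx j 0.
have e1 : cvnorm e = 1.
  rewrite /cvnorm /cdot (bigD1 j)//= big1 => [|k kj]; rewrite !mxE !eqxx/=.
    by rewrite star1 mulr1 addr0 cnorm1 sqrtr1.
  by rewrite (negPf kj) mulr0.
have := mxopnormP M e; rewrite e1 mulr1; apply: le_trans.
have -> : M i j = (M *m e) i 0; last exact: cvnorm_entry.
by rewrite -colE mxE.
Qed.

Lemma mxopnorm_eq0 M : mxopnorm M = 0 -> M = 0.
Proof.
move=> M0; apply/matrixP => i j; rewrite mxE; apply: cnorm_le0.
by rewrite -M0 mxopnorm_entry.
Qed.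

Lemma mxopnormD M N : mxopnorm (M + N) <= mxopnorm M + mxopnorm N.
Proof.
apply: mxopnorm_le => [|x]; first by rewrite addr_ge0 ?mxopnorm_ge0.
rewrite mulmxDl mulrDl; apply: le_trans (cvnormD _ _) _.
by rewrite lerD ?mxopnormP.
Qed.

Lemma mxopnormM M N : mxopnorm (M *m N) <= mxopnorm M * mxopnorm N.
Proof.
apply: mxopnorm_le => [|x]; first by rewrite mulr_ge0 ?mxopnorm_ge0.
rewrite -mulmxA -mulrA; apply: le_trans (mxopnormP _ _) _.
by rewrite ler_wpM2l ?mxopnorm_ge0// mxopnormP.
Qed.

Lemma adjmxK : involutive adjmx.
Proof. by move=> M; apply/matrixP => i j; rewrite !mxE starK. Qed.

Lemma mxopnorm_adj_le M : mxopnorm (adjmx M) <= mxopnorm M.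
Proof.
apply: mxopnorm_le => [|x]; first exact: mxopnorm_ge0.
have [->|n0] := eqVneq (cvnorm (adjmx M *m x)) 0.
  by rewrite mulr_ge0 ?mxopnorm_ge0 ?cvnorm_ge0.
have p : 0 < cvnorm (adjmx M *m x) by rewrite lt_def n0 cvnorm_ge0.
rewrite -(ler_pM2r p) -expr2 sqr_cvnorm -cdot_adj.
apply: le_trans (cauchy_schwarz _ _) _; rewrite mulrC mulrAC.
by rewrite ler_wpM2r ?cvnorm_ge0// mxopnormP.
Qed.

Lemma mxopnorm_adjM M : mxopnorm (adjmx M *m M) = mxopnorm M ^+ 2.
Proof.
apply/eqP; rewrite eq_le; apply/andP; split.
  apply: le_trans (mxopnormM _ _) _.
  by rewrite expr2 ler_wpM2r ?mxopnorm_ge0// mxopnorm_adj_le.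
rewrite -[leRHS]sqr_sqrtr ?mxopnorm_ge0// ler_sqr ?nnegrE ?sqrtr_ge0 ?mxopnorm_ge0//.
apply: mxopnorm_le => [|x]; first exact: sqrtr_ge0.
rewrite -ler_sqr ?nnegrE ?mulr_ge0 ?cvnorm_ge0 ?sqrtr_ge0//.
rewrite sqr_cvnorm exprMn sqr_sqrtr ?mxopnorm_ge0//.
have -> : cdot (M *m x) (M *m x) = cdot x (adjmx M *m M *m x).
  by rewrite -mulmxA [RHS]cdot_adj adjmxK.
apply: le_trans (cauchy_schwarz _ _) _.
by rewrite expr2 mulrCA ler_wpM2l ?cvnorm_ge0// mxopnormP.
Qed.

Lemma mxopnorm_complete (M_ : nat -> 'M[A]_n) :
  (forall e : R, 0 < e ->
    exists m, forall p q, (m <= p)%N -> (m <= q)%N -> mxopnorm (M_ p - M_ q) < e) ->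
  exists M, forall e : R, 0 < e ->
    exists m, forall p, (m <= p)%N -> mxopnorm (M_ p - M) < e.
Proof.
move=> cauchy; have lim i j : exists a, clim (fun p => M_ p i j) a.
  apply: cnorm_complete => e /cauchy[m hm]; exists m => p q mp mq.
  apply: le_lt_trans (hm p q mp mq); have := mxopnorm_entry (M_ p - M_ q) i j.
  by rewrite !mxE.
pose L := \matrix_(i, j) projT1 (cid (lim i j)); exists L => e e0.
(* Each of the n^2 entries contributes e / K; the extra 1 keeps the total strictly below e and K
   nonzero when n = 0. *)
pose K : R := (n * n)%:R + 1; have K0 : 0 < K by rewrite ltr_wpDl.
have ev (ij : 'I_n * 'I_n) : exists m, forall p, (m <= p)%N ->
    cnorm (M_ p ij.1 ij.2 - L ij.1 ij.2) < e / K.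
  by rewrite mxE; case: cid => a /= /(_ _ (divr_gt0 e0 K0)).
have [m hm] := choice ev; exists (\max_ij m ij) => p mp.
apply: le_lt_trans (mxopnorm_le_bound _) _.
have : mxbound (M_ p - L) <= \sum_(i < n) \sum_(j < n) e / K.
  do 2![apply: ler_sum => ? _]; rewrite !mxE.
  set i := (X in M_ p X); set j := (X in M_ p _ X).
  have := hm (i, j) p (leq_trans (leq_bigmax (i, j)) mp).
  by rewrite /= !mxE => /ltW.
move=> /le_lt_trans; apply; rewrite !sumr_const !card_ord -mulrnA -mulr_natl.
rewrite mulrCA gtr_pMr// ltr_pdivrMr// mul1r /K ltrDl//.
Qed.

End HilbertModule.

(** A separate name, because matrices already carry the scaling by A while a complex scaling is
    wanted. The successor keeps the algebra nonzero. *)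
Definition cmx (R : realType) (A : cstarAlgType R) (n : nat) := 'M[A]_n.+1.

Section MatrixAlgebra.
Variables (R : realType) (A : cstarAlgType R) (n : nat).
Local Notation MA := (cmx A n).

HB.instance Definition _ := GRing.NzRing.copy MA 'M[A]_n.+1.

Definition cmx_scale (c : R[i]) (M : MA) : MA := \matrix_(i, j) (c *: M i j).

Fact cmx_scaleA c d M : cmx_scale c (cmx_scale d M) = cmx_scale (c * d) M.
Proof. by apply/matrixP => i j; rewrite !mxE scalerA. Qed.

Fact cmx_scale1 : left_id 1 cmx_scale.
Proof. by move=> M; apply/matrixP => i j; rewrite !mxE scale1r. Qed.

Fact cmx_scaleDr : right_distributive cmx_scale +%R.
Proof. by move=> c M N; apply/matrixP => i j; rewrite !mxE scalerDr. Qed.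

Fact cmx_scaleDl M : {morph cmx_scale^~ M : c d / c + d}.
Proof. by move=> c d; apply/matrixP => i j; rewrite !mxE scalerDl. Qed.

HB.instance Definition _ := GRing.Zmodule_isLmodule.Build R[i] MA
  cmx_scaleA cmx_scale1 cmx_scaleDr cmx_scaleDl.

Fact cmx_scalerAl (c : R[i]) (M N : MA) : c *: (M * N) = c *: M * N.
Proof.
apply/matrixP => i j; rewrite !mxE scaler_sumr; apply: eq_bigr => k _.
by rewrite !mxE scalerAl.
Qed.

HB.instance Definition _ := GRing.Lmodule_isLalgebra.Build R[i] MA cmx_scalerAl.

Fact cmx_scalerAr (c : R[i]) (M N : MA) : c *: (M * N) = M * (c *: N).
Proof.
apply/matrixP => i j; rewrite !mxE scaler_sumr; apply: eq_bigr => k _.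
by rewrite !mxE scalerAr.
Qed.

HB.instance Definition _ := GRing.Lalgebra_isAlgebra.Build R[i] MA cmx_scalerAr.

Definition cmx_star (M : MA) : MA := adjmx M.
Definition cmx_norm (M : MA) : R := mxopnorm M.

Fact cmx_starD : {morph cmx_star : M N / M + N}.
Proof. by move=> M N; apply/matrixP => i j; rewrite !mxE starD. Qed.

Fact cmx_starZ c (M : MA) : cmx_star (c *: M) = c^* *: cmx_star M.
Proof. by apply/matrixP => i j; rewrite !mxE starZ. Qed.

Fact cmx_starM (M N : MA) : cmx_star (M * N) = cmx_star N * cmx_star M.
Proof.
apply/matrixP => i j; rewrite !mxE star_sum; apply: eq_bigr => k _.
by rewrite !mxE starM.
Qed.

Fact cmx_normZ c (M : MA) : (cmx_norm (c *: M))%:C = `|c| * (cmx_norm M)%:C.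
Proof.
apply: complex_homogeneous => [N|d N]; first exact: mxopnorm_ge0.
have d0 : 0 <= complex.Re `|d| by rewrite -ler0c RRe_real ?normr_real.
apply: mxopnorm_le => [|x]; first by rewrite mulr_ge0// mxopnorm_ge0.
have -> : (d *: N : MA) *m x = d%:A *: (N *m x).
  apply/matrixP => i j; rewrite !mxE -scalerAl mul1r scaler_sumr.
  by apply: eq_bigr => k _; rewrite mxE scalerAl.
by rewrite cvnormZ -mulrA ler_wpM2l// mxopnormP.
Qed.

HB.instance Definition _ := Algebra_isCStar.Build R MA
  (@adjmxK _ A n.+1) cmx_starD cmx_starZ cmx_starM (@mxopnorm_eq0 _ A n.+1)
  (@mxopnormD _ A n.+1) cmx_normZ (@mxopnormM _ A n.+1) (@mxopnorm_adjM _ A n.+1)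
  (@mxopnorm_complete _ A n.+1).

End MatrixAlgebra.

(** * Complex numbers and opposite algebras *)

Section ComplexAlgebra.
Variable R : realType.
Local Notation C := ((R[i])^o).

(** The limit is obtained as the lower limit, the supremum of the eventual lower bounds. *)
Lemma real_cauchy_cvg (u : nat -> R) :
  (forall e, 0 < e -> exists n, forall p q, (n <= p)%N -> (n <= q)%N -> `|u p - u q| < e) ->
  exists l, forall e, 0 < e -> exists n, forall p, (n <= p)%N -> `|u p - l| < e.
Proof.
move=> cauchy; pose S := [set x | exists n, forall p, (n <= p)%N -> x <= u p].
have lower e n : (forall p q, (n <= p)%N -> (n <= q)%N -> `|u p - u q| < e) ->
    S (u n - e).
  by move=> h; exists n => p np; move: (h n p (leqnn n) np); rewrite ltr_norml; lra.
have upper e n : (forall p q, (n <= p)%N -> (n <= q)%N -> `|u p - u q| < e) ->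
    ubound S (u n + e).
  move=> h x [m hm]; have := hm _ (leq_maxr n m).
  by move: (h n (maxn n m) (leqnn n) (leq_maxl n m)); rewrite ltr_norml; lra.
have [n0 h0] := cauchy _ ltr01.
have S0 : S !=set0 by exists (u n0 - 1); exact: lower.
have Sub : has_ubound S by exists (u n0 + 1); exact: upper.
exists (sup S) => e e0; have e2 : 0 < e / 2 by rewrite divr_gt0.
have [n h] := cauchy _ e2; exists n => p np.
have h' q r : (p <= q)%N -> (p <= r)%N -> `|u q - u r| < e / 2.
  by move=> pq pr; apply: h; [exact: leq_trans pq|exact: leq_trans pr].
have := ub_le_sup Sub (lower _ _ h'); have := ge_sup S0 (upper _ _ h').
by rewrite ltr_norml; lra.
Qed.

Definition complex_norm (z : C) : R := complex.Re `|z|.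

Fact complex_normE (z : C) : `|z : R[i]| = (complex_norm z)%:C.
Proof. by rewrite /complex_norm normc_def. Qed.

Fact complex_norm_eq0 z : complex_norm z = 0 -> z = 0.
Proof. by move=> z0; apply/eqP; rewrite -normr_eq0 complex_normE z0. Qed.

Fact complex_normD z w : complex_norm (z + w) <= complex_norm z + complex_norm w.
Proof. by rewrite -lecR rmorphD/= -!complex_normE ler_normD. Qed.

Fact complex_normM z w : complex_norm (z * w) = complex_norm z * complex_norm w.
Proof. by apply: (@complexI R); rewrite rmorphM/= -!complex_normE normrM. Qed.

Fact complex_normM_le z w : complex_norm (z * w) <= complex_norm z * complex_norm w.
Proof. by rewrite complex_normM. Qed.

Fact complex_normi : complex_norm ('i%C : C) = 1.
Proof.
apply: (@complexI R); rewrite -complex_normE normc_def/=.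
by rewrite expr0n expr1n add0r sqrtr1.
Qed.

Fact complex_normZ (c : R[i]) (z : C) :
  (complex_norm (c *: z))%:C = `|c| * (complex_norm z)%:C.
Proof. by rewrite -!complex_normE normrM. Qed.

Fact complex_norm_conjM (z : C) : complex_norm (z^* * z) = complex_norm z ^+ 2.
Proof.
apply: (@complexI R); rewrite rmorphXn/= -!complex_normE normrM norm_conjC expr2.
by [].
Qed.

Fact complex_norm_complete (z : nat -> C) :
  (forall e : R, 0 < e -> exists n, forall p q, (n <= p)%N -> (n <= q)%N ->
    complex_norm (z p - z q) < e) ->
  exists l : C, forall e : R, 0 < e -> exists n, forall p, (n <= p)%N ->
    complex_norm (z p - l) < e.
Proof.
move=> cauchy.
have reP (w : C) : `|complex.Re w| <= complex_norm w.
  by rewrite -lecR -complex_normE normc_ge_Re.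
have imP (w : C) : `|complex.Im w| <= complex_norm w.
  rewrite -(opprK (complex.Im w)) normrN -ReiNIm.
  apply: le_trans (reP _) _; rewrite (complex_normM w).
  by rewrite complex_normi mulr1.
have sub (f : C -> R) : (forall v w, f (v - w) = f v - f w) ->
    (forall w, `|f w| <= complex_norm w) ->
    exists l, forall e, 0 < e -> exists n, forall p, (n <= p)%N -> `|f (z p) - l| < e.
  move=> fB fle; apply: real_cauchy_cvg => e /cauchy[n h]; exists n => p q np nq.
  by rewrite -fB; apply: le_lt_trans (h p q np nq).
have [a ha] := sub (@complex.Re R) (fun v w => raddfB _ v w) reP.
have [b hb] := sub (@complex.Im R) (fun v w => raddfB _ v w) imP.
exists (a +i* b)%C => e e0; have e2 : 0 < e / 2 by rewrite divr_gt0.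
have [n hn] := ha _ e2; have [m hm] := hb _ e2.
exists (maxn n m) => p; rewrite geq_max => /andP[/hn h1 /hm h2].
have -> : z p - (a +i* b)%C =
    (complex.Re (z p) - a)%:C + 'i%C * (complex.Im (z p) - b)%:C.
  case: (z p) => x y; apply/eqP; rewrite eq_complex/=.
  by apply/andP; split; apply/eqP; ring.
apply: le_lt_trans (complex_normD _ _) _.
have normR (x : R) : complex_norm (x%:C : C) = `|x|.
  by apply: (@complexI R); rewrite -complex_normE normc_def/= expr0n addr0 sqrtr_sqr.
rewrite (complex_normM 'i%C) complex_normi mul1r !normR; lra.
Qed.

HB.instance Definition _ := Algebra_isCStar.Build R C
  (@conjCK R[i]) (fun a b => rmorphD _ a b) (fun c a => rmorphM _ c a)
  (fun a b => etrans (rmorphM _ a b) (mulrC _ _))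
  complex_norm_eq0 complex_normD complex_normZ
  complex_normM_le complex_norm_conjM complex_norm_complete.

End ComplexAlgebra.

(** An antimultiplicative map becomes a morphism into the opposite algebra, so that the universal
    property of C(G) can produce the antipode. *)
Definition copp (R : realType) (A : cstarAlgType R) : Type := A.

Section OppositeAlgebra.
Variables (R : realType) (A : cstarAlgType R).
Local Notation Ao := (copp A).

HB.instance Definition _ := GRing.Lmodule.copy Ao A.

Definition copp_mul (a b : Ao) : Ao := (b : A) * (a : A).
Definition copp_one : Ao := (1 : A).

Fact copp_mulA : associative copp_mul.
Proof. by move=> a b c; rewrite /copp_mul mulrA. Qed.
Fact copp_mul1 : left_id copp_one copp_mul. Proof. by move=> a; exact: mulr1. Qed.
Fact copp_1mul : right_id copp_one copp_mul. Proof. by move=> a; exact: mul1r. Qed.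
Fact copp_mulDl : left_distributive copp_mul +%R.
Proof. by move=> a b c; exact: mulrDr. Qed.
Fact copp_mulDr : right_distributive copp_mul +%R.
Proof. by move=> a b c; exact: mulrDl. Qed.
Fact copp_1neq0 : copp_one != 0. Proof. exact: oner_neq0. Qed.

HB.instance Definition _ := GRing.Zmodule_isNzRing.Build Ao
  copp_mulA copp_mul1 copp_1mul copp_mulDl copp_mulDr copp_1neq0.

Fact copp_scalerAl (c : R[i]) (a b : Ao) : c *: (a * b) = (c *: a : Ao) * b.
Proof. exact: (@scalerAr _ A c b a). Qed.
HB.instance Definition _ := GRing.Lmodule_isLalgebra.Build R[i] Ao copp_scalerAl.

Fact copp_scalerAr (c : R[i]) (a b : Ao) : c *: (a * b) = a * (c *: b : Ao).
Proof. exact: (@scalerAl _ A c b a). Qed.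
HB.instance Definition _ := GRing.Lalgebra_isAlgebra.Build R[i] Ao copp_scalerAr.

Definition copp_star (a : Ao) : Ao := star (a : A).
Definition copp_norm (a : Ao) : R := cnorm (a : A).

Fact copp_starM (a b : Ao) : copp_star (a * b) = copp_star b * copp_star a.
Proof. exact: (@starM R A b a). Qed.
Fact copp_normM (a b : Ao) : copp_norm (a * b) <= copp_norm a * copp_norm b.
Proof. rewrite mulrC; exact: (@cnormM R A b a). Qed.
Fact copp_norm_starM (a : Ao) : copp_norm (copp_star a * a) = copp_norm a ^+ 2.
Proof.
have := @cnorm_starM R A (star (a : A)); rewrite starK cnorm_star; exact.
Qed.

HB.instance Definition _ := Algebra_isCStar.Build R Ao
  (@starK R A) (@starD R A) (@starZ R A) copp_starM (@cnorm_eq0 R A)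
  (@cnormD R A) (@cnormZ R A) copp_normM copp_norm_starM (@cnorm_complete R A).

Lemma copp_mulE (a b : Ao) : a * b = (b : A) * (a : A) :> A. Proof. by []. Qed.

End OppositeAlgebra.

(** * Universal C*-algebras and the maximal tensor product *)

Lemma lrmorphism_of (R : realType) (A B : cstarAlgType R) (f : A -> B) :
  (forall (c : R[i]) (a b : A), f (c *: a + b) = c *: f a + f b) -> f 1 = 1 ->
  (forall a b : A, f (a * b) = f a * f b) ->
  exists g : {lrmorphism A -> B}, forall a : A, g a = f a.
Proof.
move=> fL f1 fM.
pose fLm := GRing.isLinear.Build R[i] A B _ f fL.
pose fMm := GRing.isMonoidMorphism.Build A B f (f1, fM).
pose g : {lrmorphism A -> B} := HB.pack f fLm fMm.
by exists g.
Qed.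

Section UniversalAlgebra.
Variables (R : realType) (I : Type).
Variables (P : forall B : cstarAlgType R, (I -> B) -> Prop) (K : I -> R).
Arguments P {B}.
Hypothesis P_bounded : forall (B : cstarAlgType R) (b : I -> B), P b ->
  forall i, cnorm (b i) <= K i.
Variables (B0 : cstarAlgType R) (b0 : I -> B0).
Hypothesis P0 : P b0.

(** Formal noncommutative polynomials with involution: unlike elements of one algebra, they can be
    evaluated in all representations at once. *)
Inductive cterm : Type :=
  | CGen (i : I) | COne | CAdd (s t : cterm) | CScale (c : R[i]) (t : cterm)
  | CMul (s t : cterm) | CStar (t : cterm).

Fixpoint ceval (B : cstarAlgType R) (b : I -> B) (t : cterm) : B :=
  match t with
  | CGen i => b i
  | COne => 1
  | CAdd s t => ceval b s + ceval b t
  | CScale c t => c *: ceval b t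
  | CMul s t => ceval b s * ceval b t
  | CStar t => star (ceval b t)
  end.

(** A single bound serves all representations; this is what makes the supremum in [unorm] finite. *)
Lemma ceval_bounded t : exists2 M : R, 0 <= M &
  forall (B : cstarAlgType R) (b : I -> B), P b -> cnorm (ceval b t) <= M.
Proof.
elim: t => [i||s [M M0 hM] t [L L0 hL]|c t [M M0 hM]|s [M M0 hM] t [L L0 hL]
  |t [M M0 hM]] /=.
- by exists `|K i| => // B b Pb; apply: le_trans (P_bounded Pb i) (ler_norm _).
- by exists 1 => // B b _; rewrite cnorm1.
- exists (M + L) => [|B b Pb]; first exact: addr_ge0.
  by apply: le_trans (cnormD _ _) _; rewrite lerD ?hM ?hL.
- exists (complex_norm c * M) => [|B b Pb]; first by rewrite mulr_ge0 ?cnorm_ge0.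
  rewrite -lecR cnormZ rmorphM/= -complex_normE ler_wpM2l// lecR hM//.
- exists (M * L) => [|B b Pb]; first exact: mulr_ge0.
  by apply: le_trans (cnormM _ _) _; rewrite ler_pM ?cnorm_ge0 ?hM ?hL.
- by exists M => // B b Pb; rewrite cnorm_star hM.
Qed.

Definition ucauchy (u : nat -> cterm) : Prop := forall e : R, 0 < e -> exists n,
  forall p q, (n <= p)%N -> (n <= q)%N -> forall (B : cstarAlgType R) (b : I -> B),
  P b -> cnorm (ceval b (u p) - ceval b (u q)) < e.

Lemma ucauchy_bounded u : ucauchy u -> exists M, forall p
  (B : cstarAlgType R) (b : I -> B), P b -> cnorm (ceval b (u p)) <= M.
Proof.
move=> /(_ 1 ltr01)[n hn].
suff [M hM] : exists M, forall p, (p <= n)%N ->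
    forall (B : cstarAlgType R) (b : I -> B), P b -> cnorm (ceval b (u p)) <= M.
  exists (M + 1) => p B b Pb; have [/hM/(_ _ _ Pb)|np] := leqP p n; first by lra.
  have := hn p n (ltnW np) (leqnn n) B b Pb; have := hM n (leqnn n) B b Pb.
  have := cnormD (ceval b (u p) - ceval b (u n)) (ceval b (u n)); rewrite subrK.
  by lra.
elim: n {hn} => [|n [M hM]].
  have [M _ hM] := ceval_bounded (u 0%N); exists M => p.
  by rewrite leqn0 => /eqP ->.
have [L _ hL] := ceval_bounded (u n.+1); exists (Num.max M L) => p.
rewrite leq_eqVlt => /predU1P[->|pn] B b Pb; rewrite le_max.
  by rewrite hL// orbT.
by rewrite hM.
Qed.

Lemma ucauchy_cst t : ucauchy (fun=> t).
Proof. by move=> e e0; exists 0%N => p q _ _ B b _; rewrite subrr cnorm0. Qed.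

Lemma ucauchyD u v : ucauchy u -> ucauchy v -> ucauchy (fun n => CAdd (u n) (v n)).
Proof.
move=> cu cv e e0; have e2 : 0 < e / 2 by rewrite divr_gt0.
have [n hn] := cu _ e2; have [m hm] := cv _ e2; exists (maxn n m) => p q.
rewrite !geq_max => /andP[np mp] /andP[nq mq] B b Pb /=.
rewrite opprD addrACA; apply: le_lt_trans (cnormD _ _) _.
by have := hn p q np nq B b Pb; have := hm p q mp mq B b Pb; lra.
Qed.

Lemma ucauchy_star u : ucauchy u -> ucauchy (fun n => CStar (u n)).
Proof.
move=> cu e /cu[n hn]; exists n => p q np nq B b Pb /=.
by rewrite -starB cnorm_star hn.
Qed.

Lemma ucauchyM u v : ucauchy u -> ucauchy v -> ucauchy (fun n => CMul (u n) (v n)).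
Proof.
move=> cu cv; have [M hM] := ucauchy_bounded cu; have [L hL] := ucauchy_bounded cv.
have M0 : 0 <= M by apply: le_trans (cnorm_ge0 _) (hM 0%N _ _ P0).
have L0 : 0 <= L by apply: le_trans (cnorm_ge0 _) (hL 0%N _ _ P0).
pose k := M + L + 1; have k0 : 0 < k by rewrite ltr_wpDl// addr_ge0.
move=> e e0; have e2 : 0 < e / k by rewrite divr_gt0.
have [n hn] := cu _ e2; have [m hm] := cv _ e2; exists (maxn n m) => p q.
rewrite !geq_max => /andP[np mp] /andP[nq mq] B b Pb /=.
have -> : ceval b (u p) * ceval b (v p) - ceval b (u q) * ceval b (v q) =
    ceval b (u p) * (ceval b (v p) - ceval b (v q)) +
    (ceval b (u p) - ceval b (u q)) * ceval b (v q).
  by rewrite mulrBr mulrBl subrKA.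
apply: le_lt_trans (cnormD _ _) _.
apply: (@le_lt_trans _ _ (M * (e / k) + (e / k) * L)).
  apply: lerD; apply: le_trans (cnormM _ _) _; rewrite ler_pM ?cnorm_ge0 ?hM ?hL//.
    by rewrite ltW// hm.
  by rewrite ltW// hn.
by rewrite (mulrC (e / k)) -mulrDl mulrCA gtr_pMr// ltr_pdivrMr// mul1r ltrDl.
Qed.

Lemma ucauchyZ c u : ucauchy u -> ucauchy (fun n => CScale c (u n)).
Proof.
move=> cu; have := ucauchyM (ucauchy_cst (CScale c COne)) cu.
move=> h e /h[n hn]; exists n => p q np nq B b Pb.
by have := hn p q np nq B b Pb; rewrite /= !mulr_algl.
Qed.

(* The universal algebra consists of the sequences of terms that are Cauchy
   uniformly in all representations, up to equality of all their limits. *)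
Definition cseq := {classic {u : nat -> cterm | ucauchy u}}.

Definition cval (u : cseq) : nat -> cterm := sval u.

(** When b satisfies P, the limit exists by completeness of B and the default branch is not
    taken. *)
Definition clim_eval (B : cstarAlgType R) (b : I -> B) (u : cseq) : B :=
  xget 0 [set l | clim (fun n => ceval b (cval u n)) l].

Lemma clim_evalP (B : cstarAlgType R) (b : I -> B) (u : cseq) : P b ->
  clim (fun n => ceval b (cval u n)) (clim_eval b u).
Proof.
move=> Pb; rewrite /clim_eval; case: xgetP => // none.
case: u none => u cu /= none; have [|l hl] := cnorm_complete (fun n => ceval b (u n)).
  by move=> e /cu[n hn]; exists n => p q np nq; exact: hn.
by have := none l hl.
Qed.

Definition cseq_eqb (u v : cseq) : bool := `[< forall (B : cstarAlgType R) (b : I -> B),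
  P b -> clim_eval b u = clim_eval b v >].

Lemma cseq_eqb_equiv : equiv_class_of cseq_eqb.
Proof.
split => [u|u v|v u w].
- exact/asboolP.
- by apply/asboolP/asboolP => h B b Pb; rewrite h.
- by move=> /asboolP uv /asboolP vw; apply/asboolP => B b Pb; rewrite uv// vw.
Qed.

Canonical cseq_eqb_equivRel := EquivRelPack cseq_eqb_equiv.

Definition ualg := {eq_quot cseq_eqb}%qT.
HB.instance Definition _ := Choice.on ualg.
HB.instance Definition _ := EqQuotient.on ualg.

Definition uclass (u : nat -> cterm) (cu : ucauchy u) : ualg :=
  (\pi_ualg (exist _ u cu : cseq))%qT.

Definition uev (B : cstarAlgType R) (b : I -> B) (x : ualg) : B :=
  clim_eval b (repr x).

Lemma uevP (B : cstarAlgType R) (b : I -> B) (x : ualg) : P b ->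
  clim (fun n => ceval b (cval (repr x) n)) (uev b x).
Proof. exact: clim_evalP. Qed.

Lemma uev_class (B : cstarAlgType R) (b : I -> B) u (cu : ucauchy u) : P b ->
  clim (fun n => ceval b (u n)) (uev b (uclass cu)).
Proof.
move=> Pb; have -> : uev b (uclass cu) = clim_eval b (exist _ u cu : cseq).
  have : cseq_eqb (repr (uclass cu)) (exist _ u cu) by apply/eqmodP; rewrite reprK.
  by move=> /asboolP; apply.
exact: (@clim_evalP B b (exist _ u cu : cseq)).
Qed.

(** Representations separate points, so every algebraic law of [ualg] reduces to the same law in
    each B. *)
Lemma ualg_ext (x y : ualg) : (forall (B : cstarAlgType R) (b : I -> B), P b ->
  uev b x = uev b y) -> x = y.
Proof. by move=> h; rewrite -(reprK x) -(reprK y); apply/eqmodP/asboolP. Qed.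

Lemma uev_classE (B : cstarAlgType R) (b : I -> B) u (cu : ucauchy u) v : P b ->
  (forall n, ceval b (u n) = v n) -> clim v (uev b (uclass cu)).
Proof. by move=> Pb uv; apply: eq_clim uv (uev_class cu Pb). Qed.

Definition uadd (x y : ualg) : ualg :=
  uclass (ucauchyD (svalP (repr x : cseq)) (svalP (repr y : cseq))).
Definition umul (x y : ualg) : ualg :=
  uclass (ucauchyM (svalP (repr x : cseq)) (svalP (repr y : cseq))).
Definition uscale c (x : ualg) : ualg := uclass (ucauchyZ c (svalP (repr x : cseq))).
Definition ustar (x : ualg) : ualg := uclass (ucauchy_star (svalP (repr x : cseq))).
Definition uterm t : ualg := uclass (ucauchy_cst t).
Definition uopp (x : ualg) : ualg := uscale (- 1) x.
Definition uzero : ualg := uterm (CScale 0 COne).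
Definition uone : ualg := uterm COne.

Section Evaluation.
Variables (B : cstarAlgType R) (b : I -> B).
Hypothesis Pb : P b.

Lemma uev_add x y : uev b (uadd x y) = uev b x + uev b y.
Proof. by apply: clim_unique (climD (uevP x Pb) (uevP y Pb)); exact: uev_classE. Qed.

Lemma uev_mul x y : uev b (umul x y) = uev b x * uev b y.
Proof. by apply: clim_unique (climM (uevP x Pb) (uevP y Pb)); exact: uev_classE. Qed.

Lemma uev_scale c x : uev b (uscale c x) = c *: uev b x.
Proof. by apply: clim_unique (climZ c (uevP x Pb)); exact: uev_classE. Qed.

Lemma uev_star x : uev b (ustar x) = star (uev b x).
Proof. by apply: clim_unique (clim_star (uevP x Pb)); exact: uev_classE. Qed.

Lemma uev_term t : uev b (uterm t) = ceval b t.
Proof. by apply: clim_unique (clim_cst _); exact: uev_classE. Qed.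

Lemma uev_opp x : uev b (uopp x) = - uev b x.
Proof. by rewrite uev_scale scaleN1r. Qed.

Lemma uev_zero : uev b uzero = 0. Proof. by rewrite uev_term /= scale0r. Qed.

Lemma uev_one : uev b uone = 1. Proof. exact: uev_term. Qed.

End Evaluation.

Definition uevE := (uev_add, uev_opp, uev_zero, uev_one, uev_mul, uev_scale, uev_star).

Fact uaddA : associative uadd.
Proof. by move=> x y z; apply: ualg_ext => B b Pb; rewrite !uevE// addrA. Qed.
Fact uaddC : commutative uadd.
Proof. by move=> x y; apply: ualg_ext => B b Pb; rewrite !uevE// addrC. Qed.
Fact uadd0 : left_id uzero uadd.
Proof. by move=> x; apply: ualg_ext => B b Pb; rewrite !uevE// add0r. Qed.
Fact uaddN : left_inverse uzero uopp uadd.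
Proof. by move=> x; apply: ualg_ext => B b Pb; rewrite !uevE// addNr. Qed.

HB.instance Definition _ := GRing.isZmodule.Build ualg uaddA uaddC uadd0 uaddN.

Fact umulA : associative umul.
Proof. by move=> x y z; apply: ualg_ext => B b Pb; rewrite !uevE// mulrA. Qed.
Fact umul1l : left_id uone umul.
Proof. by move=> x; apply: ualg_ext => B b Pb; rewrite !uevE// mul1r. Qed.
Fact umul1r : right_id uone umul.
Proof. by move=> x; apply: ualg_ext => B b Pb; rewrite !uevE// mulr1. Qed.
Fact umulDl : left_distributive umul +%R.
Proof. by move=> x y z; apply: ualg_ext => B b Pb; rewrite !uevE// mulrDl. Qed.
Fact umulDr : right_distributive umul +%R.
Proof. by move=> x y z; apply: ualg_ext => B b Pb; rewrite !uevE// mulrDr. Qed.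
Fact uone_neq0 : uone != 0.
Proof.
apply/eqP => /(congr1 (uev b0)); rewrite !uevE// => /eqP.
by rewrite oner_eq0.
Qed.

HB.instance Definition _ := GRing.Zmodule_isNzRing.Build ualg
  umulA umul1l umul1r umulDl umulDr uone_neq0.

Fact uscaleA c d x : uscale c (uscale d x) = uscale (c * d) x.
Proof. by apply: ualg_ext => B b Pb; rewrite !uevE// scalerA. Qed.
Fact uscale1 : left_id 1 uscale.
Proof. by move=> x; apply: ualg_ext => B b Pb; rewrite !uevE// scale1r. Qed.
Fact uscaleDr : right_distributive uscale +%R.
Proof. by move=> c x y; apply: ualg_ext => B b Pb; rewrite !uevE// scalerDr. Qed.
Fact uscaleDl x : {morph uscale^~ x : c d / c + d}.
Proof. by move=> c d; apply: ualg_ext => B b Pb; rewrite !uevE// scalerDl. Qed.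

HB.instance Definition _ := GRing.Zmodule_isLmodule.Build R[i] ualg
  uscaleA uscale1 uscaleDr uscaleDl.

Fact uscalerAl (c : R[i]) (x y : ualg) : c *: (x * y) = (c *: x : ualg) * y.
Proof. by apply: ualg_ext => B b Pb; rewrite !uevE// scalerAl. Qed.
HB.instance Definition _ := GRing.Lmodule_isLalgebra.Build R[i] ualg uscalerAl.

Fact uscalerAr (c : R[i]) (x y : ualg) : c *: (x * y) = x * (c *: y : ualg).
Proof. by apply: ualg_ext => B b Pb; rewrite !uevE// scalerAr. Qed.
HB.instance Definition _ := GRing.Lalgebra_isAlgebra.Build R[i] ualg uscalerAr.

(* A supremum over all C*-algebras: this set of reals is small since [Prop] is
   impredicative. *)
Definition unorm (x : ualg) : R := sup [set r | exists (B : cstarAlgType R) (b : I -> B),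
  P b /\ r = cnorm (uev b x)].

Lemma unorm_has_sup x : has_sup [set r | exists (B : cstarAlgType R) (b : I -> B),
  P b /\ r = cnorm (uev b x)].
Proof.
split; first by exists (cnorm (uev b0 x)), B0, b0.
have [M hM] := ucauchy_bounded (svalP (repr x : cseq)).
exists M => _ [B [b [Pb ->]]]; apply: clim_norm_le (uevP x Pb) => n.
exact: hM.
Qed.

Lemma uev_norm (B : cstarAlgType R) (b : I -> B) x : P b -> cnorm (uev b x) <= unorm x.
Proof.
by move=> Pb; apply: ub_le_sup; [case: (unorm_has_sup x)|exists B, b].
Qed.

Lemma unorm_le x k : (forall (B : cstarAlgType R) (b : I -> B), P b ->
  cnorm (uev b x) <= k) -> unorm x <= k.
Proof.
move=> h; apply: ge_sup; first by case: (unorm_has_sup x).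
by move=> _ [B [b [Pb ->]]]; exact: h.
Qed.

Lemma unorm_ge0 x : 0 <= unorm x.
Proof. exact: le_trans (cnorm_ge0 _) (uev_norm x P0). Qed.

Fact ustarK : involutive ustar.
Proof. by move=> x; apply: ualg_ext => B b Pb; rewrite !uevE// starK. Qed.
Fact ustarD : {morph ustar : x y / x + y}.
Proof. by move=> x y; apply: ualg_ext => B b Pb; rewrite !uevE// starD. Qed.
Fact ustarZ (c : R[i]) (x : ualg) : ustar (c *: x) = c^* *: ustar x.
Proof. by apply: ualg_ext => B b Pb; rewrite !uevE// starZ. Qed.
Fact ustarM (x y : ualg) : ustar (x * y) = ustar y * ustar x.
Proof. by apply: ualg_ext => B b Pb; rewrite !uevE// starM. Qed.

Fact unorm_eq0 x : unorm x = 0 -> x = 0.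
Proof.
move=> x0; apply: ualg_ext => B b Pb; rewrite !uevE//; apply: cnorm_le0.
by rewrite -x0 uev_norm.
Qed.

Fact unormD x y : unorm (x + y) <= unorm x + unorm y.
Proof.
apply: unorm_le => B b Pb; rewrite uevE//.
by apply: le_trans (cnormD _ _) _; rewrite lerD ?uev_norm.
Qed.

Fact unormZ (c : R[i]) (x : ualg) : (unorm (c *: x))%:C = `|c| * (unorm x)%:C.
Proof.
apply: complex_homogeneous => {c x}[|c x]; first exact: unorm_ge0.
apply: unorm_le => B b Pb; rewrite uevE// -lecR cnormZ rmorphM/= -complex_normE.
by rewrite ler_wpM2l// lecR uev_norm.
Qed.

Fact unormM x y : unorm (x * y) <= unorm x * unorm y.
Proof.
apply: unorm_le => B b Pb; rewrite uevE//.
by apply: le_trans (cnormM _ _) _; rewrite ler_pM ?cnorm_ge0 ?uev_norm.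
Qed.

Fact unorm_starM x : unorm (ustar x * x) = unorm x ^+ 2.
Proof.
apply/eqP; rewrite eq_le; apply/andP; split.
  apply: unorm_le => B b Pb; rewrite !uevE// cnorm_starM.
  by rewrite ler_sqr ?nnegrE ?cnorm_ge0 ?unorm_ge0 ?uev_norm.
rewrite -[leRHS]sqr_sqrtr ?unorm_ge0// ler_sqr ?nnegrE ?sqrtr_ge0 ?unorm_ge0//.
apply: unorm_le => B b Pb.
rewrite -ler_sqr ?nnegrE ?cnorm_ge0 ?sqrtr_ge0// sqr_sqrtr ?unorm_ge0//.
by rewrite -cnorm_starM -!uevE// uev_norm.
Qed.

Lemma uterm_approx x e : 0 < e -> exists t, forall (B : cstarAlgType R) (b : I -> B),
  P b -> cnorm (uev b x - ceval b t) <= e.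
Proof.
move=> e0; have [n hn] := svalP (repr x : cseq) e e0.
exists (cval (repr x) n) => B b Pb; rewrite cnormBC.
apply/ler_addgt0Pr => d d0; have [m hm] := uevP x Pb d0.
have := hm _ (leq_maxr n m); have := hn n _ (leqnn n) (leq_maxl n m) B b Pb.
have := cnorm_triangle (ceval b (cval (repr x) (maxn n m)))
  (ceval b (cval (repr x) n)) (uev b x).
by rewrite /cval; lra.
Qed.

(** A diagonal argument: x_n is replaced by a term within 1 / (n + 1) of it in every representation,
    and the sequence of these terms is itself an element of the algebra, the limit. *)
Fact unorm_complete (x_ : nat -> ualg) :
  (forall e : R, 0 < e -> exists n, forall p q, (n <= p)%N -> (n <= q)%N ->
    unorm (x_ p - x_ q) < e) ->
  exists x, forall e : R, 0 < e -> exists n, forall p, (n <= p)%N -> unorm (x_ p - x) < e.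
Proof.
move=> cauchy; have inv0 n : 0 < n.+1%:R^-1 :> R by rewrite invr_gt0.
have small (e : R) : 0 < e -> exists n, forall p, (n <= p)%N -> p.+1%:R^-1 < e.
  move=> e0; exists (Num.bound e^-1) => p np.
  rewrite invf_plt ?posrE//; have ie0 : 0 <= e^-1 by rewrite invr_ge0 ltW.
  by apply: lt_le_trans (archi_boundP ie0) _; rewrite ler_nat ltnW.
have [t ht] := choice (fun n => uterm_approx (x_ n) (inv0 n)).
have ct : ucauchy t.
  move=> e e0; have e3 : 0 < e / 3 by rewrite divr_gt0.
  have [n hn] := small _ e3; have [m hm] := cauchy _ e3.
  exists (maxn n m) => p q; rewrite !geq_max => /andP[np mp] /andP[nq mq] B b Pb.
  have := le_lt_trans (ht p B b Pb) (hn _ np).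
  have := le_lt_trans (ht q B b Pb) (hn _ nq).
  have := hm p q mp mq; have := uev_norm (x_ p - x_ q) Pb.
  rewrite !uevE//.
  have := cnorm_triangle (uev b (x_ p)) (ceval b (t p)) (ceval b (t q)).
  have := cnorm_triangle (uev b (x_ q)) (uev b (x_ p)) (ceval b (t q)).
  rewrite (cnormBC (ceval b (t p)) (uev b (x_ p))).
  by lra.
exists (uclass ct) => e e0; have e4 : 0 < e / 4 by rewrite divr_gt0.
have [n hn] := small _ e4; have [m hm] := ct _ e4.
exists (maxn n m) => p; rewrite geq_max => /andP[np mp].
suff : unorm (x_ p - uclass ct) <= e / 4 + e / 4 + e / 4 by lra.
apply: unorm_le => B b Pb; rewrite !uevE//.
have [l hl] := uev_class ct Pb e4.
have := hl _ (leq_maxr p l); have := hm p _ mp (leq_trans mp (leq_maxl p l)) B b Pb.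
have := le_lt_trans (ht p B b Pb) (hn _ np).
have := cnorm_triangle (ceval b (t p)) (uev b (x_ p)) (uev b (uclass ct)).
have := cnorm_triangle (ceval b (t (maxn p l))) (ceval b (t p)) (uev b (uclass ct)).
by lra.
Qed.

HB.instance Definition _ := Algebra_isCStar.Build R ualg
  ustarK ustarD ustarZ ustarM unorm_eq0 unormD unormZ unormM unorm_starM unorm_complete.

Lemma uev_morphism (B : cstarAlgType R) (b : I -> B) : P b ->
  exists2 f : {lrmorphism ualg -> B}, star_preserving f & forall x, f x = uev b x.
Proof.
move=> Pb; have [|||f hf] := @lrmorphism_of R ualg B (uev b).
- by move=> c x y; rewrite !uevE.
- by rewrite uevE.
- by move=> x y; rewrite uevE.
by exists f => // x; rewrite !hf uevE.
Qed.

Lemma ualg_generated : generates (range (fun i => uterm (CGen i))).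
Proof.
apply/seteqP; split => // x _ S [[Scl S1 SL SM Ss] gen].
have S0 : S 0.
  by have := SL (- 1) 1 1 S1 S1; rewrite scaleN1r addNr.
have SZ c y : S y -> S (c *: y) by move=> Sy; rewrite -[_ *: _]addr0; exact: SL.
have St t : S (uterm t).
  elim: t => [i||s IHs t IHt|c t IHt|s IHs t IHt|t IHt].
  - by apply: gen; exists i.
  - exact: S1.
  - have -> : uterm (CAdd s t) = 1 *: uterm s + uterm t; last exact: SL.
    by apply: ualg_ext => B b Pb; rewrite !uevE// !uev_term//= scale1r.
  - have -> : uterm (CScale c t) = c *: uterm t; last exact: SZ.
    by apply: ualg_ext => B b Pb; rewrite !uevE// !uev_term.
  - have -> : uterm (CMul s t) = uterm s * uterm t; last exact: SM.
    by apply: ualg_ext => B b Pb; rewrite !uevE// !uev_term.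
  - have -> : uterm (CStar t) = star (uterm t); last exact: Ss.
    by apply: ualg_ext => B b Pb; rewrite !uevE// !uev_term.
apply: Scl => e e0; have e2 : 0 < e / 2 by rewrite divr_gt0.
have [t ht] := uterm_approx x e2; exists (uterm t) => //.
suff : cnorm (uterm t - x) <= e / 2 by lra.
by apply: unorm_le => B b Pb; rewrite !uevE// uev_term// cnormBC ht.
Qed.

(** The last clause replaces the assertion that the generators of T satisfy P. A condition like
    [commuting_pair] asks for morphisms and is not an equation, but the equations that follow from
    it can be checked in all representations and lifted to T. *)
Lemma universal_algebra_exists : exists (T : cstarAlgType R) (a : I -> T),
  [/\ generates (range a),
      (forall (B : cstarAlgType R) (b : I -> B), P b ->
        exists2 f : {lrmorphism T -> B}, star_preserving f & forall i, f (a i) = b i) &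
      (forall x y : T,
        (forall (B : cstarAlgType R) (f : {lrmorphism T -> B}), star_preserving f ->
          P (f \o a) -> f x = f y) -> x = y)].
Proof.
exists ualg, (fun i => uterm (CGen i)); split; first exact: ualg_generated.
- move=> B b Pb; have [f fs hf] := uev_morphism Pb; exists f => // i.
  by rewrite hf uev_term.
- move=> x y h; apply: ualg_ext => B b Pb; have [f fs hf] := uev_morphism Pb.
  rewrite -!hf; apply: h => //; suff -> : f \o (fun i => uterm (CGen i)) = b by [].
  by apply/funext => i /=; rewrite hf uev_term.
Qed.

End UniversalAlgebra.

Section MaxTensor.
Variables (R : realType) (A B : cstarAlgType R).

(** All elements of A and B serve as generators: the relations then say that the two restrictions
    are commuting morphisms, and contractivity bounds each generator by its own norm. *)
Definition commuting_pair (T : cstarAlgType R) (c : A + B -> T) : Prop :=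
  exists (jA : {lrmorphism A -> T}) (jB : {lrmorphism B -> T}),
    [/\ star_preserving jA, star_preserving jB,
        (forall a b, jA a * jB b = jB b * jA a),
        (forall a, c (inl a) = jA a) & (forall b, c (inr b) = jB b)].

Lemma max_tensor_of_pair (T0 : cstarAlgType R) (c0 : A + B -> T0) : commuting_pair c0 ->
  exists (T : cstarAlgType R) (iA : {lrmorphism A -> T}) (iB : {lrmorphism B -> T}),
    max_tensor iA iB.
Proof.
move=> c0P; pose K (i : A + B) := match i with inl a => cnorm a | inr b => cnorm b end.
have bounded (T : cstarAlgType R) (c : A + B -> T) : commuting_pair c ->
    forall i, cnorm (c i) <= K i.
  by move=> [jA [jB [As Bs _ cA cB]]] [a|b]; rewrite ?cA ?cB cnorm_morph_le.
have [T [g [gen univ ext]]] := universal_algebra_exists bounded c0P.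
have [|||iA hA] := @lrmorphism_of R A T (g \o inl).
- move=> c a b; apply: ext => T' f fs [jA [jB [As Bs _ /= cA cB]]].
  by rewrite /= linearP /= !cA linearP.
- apply: ext => T' f fs [jA [jB [As Bs _ /= cA cB]]].
  by rewrite /= cA !rmorph1.
- move=> a b; apply: ext => T' f fs [jA [jB [As Bs _ /= cA cB]]].
  by rewrite /= rmorphM /= !cA rmorphM.
have [|||iB hB] := @lrmorphism_of R B T (g \o inr).
- move=> c a b; apply: ext => T' f fs [jA [jB [As Bs _ /= cA cB]]].
  by rewrite /= linearP /= !cB linearP.
- apply: ext => T' f fs [jA [jB [As Bs _ /= cA cB]]].
  by rewrite /= cB !rmorph1.
- move=> a b; apply: ext => T' f fs [jA [jB [As Bs _ /= cA cB]]].
  by rewrite /= rmorphM /= !cB rmorphM.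
exists T, iA, iB; split.
- split=> a; rewrite ?hA ?hB; apply: ext => T' f fs [jA [jB [As Bs _ /= cA cB]]].
    by rewrite fs !cA As.
  by rewrite fs !cB Bs.
- move=> a b; rewrite hA hB; apply: ext => T' f fs [jA [jB [As Bs AB /= cA cB]]].
  by rewrite !rmorphM /= cA cB AB.
- suff -> : range iA `|` range iB = range g by [].
  apply/seteqP; split => [x [[a _ <-]|[b _ <-]]|_ [[a|b] _ <-]].
  + by exists (inl a).
  + by exists (inr b).
  + by left; exists a.
  + by right; exists b.
- move=> T' jA jB As Bs AB.
  pose c (i : A + B) := match i with inl a => jA a | inr b => jB b end.
  have [|f fs fg] := univ T' c; first by exists jA, jB.
  by exists f => //; split => x; rewrite ?hA ?hB /= fg.
Qed.

(** Scalars commute with everything, so the character and the identity of B form a commuting pair in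
    B. For a quantum group the character is the counit. *)
Lemma max_tensor_of_character (eps : {lrmorphism A -> (R[i])^o}) :
  (forall a, eps (star a) = (eps a)^*) ->
  exists (T : cstarAlgType R) (iA : {lrmorphism A -> T}) (iB : {lrmorphism B -> T}),
    max_tensor iA iB.
Proof.
move=> eps_star; have [|||jA hA] := @lrmorphism_of R A B (fun a => (eps a)%:A).
- by move=> c a b; rewrite linearP scalerDl scalerA.
- by rewrite rmorph1 scale1r.
- by move=> a b; rewrite rmorphM -scalerAl mul1r scalerA.
apply: (@max_tensor_of_pair B (fun i => match i with inl a => jA a | inr b => b end)).
exists jA, idfun; split => // [a|a b].
- by rewrite !hA eps_star starZ star1.
- by rewrite hA /= -scalerAl -scalerAr mul1r mulr1.
Qed.

End MaxTensor.

(** * Duals of groups generated by involutions *)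

Section GroupDuals.
Variables (R : realType) (N : nat).
Implicit Types (A B : cstarAlgType R).

Definition symmetries A (v : 'I_N -> A) : Prop :=
  forall i, star (v i) = v i /\ v i * v i = 1.

Definition half_commuting A (v : 'I_N -> A) : Prop :=
  forall a b c, v a * v b * v c = v c * v b * v a.

Definition commuting A (v : 'I_N -> A) : Prop := forall a b, v a * v b = v b * v a.

(** The common form of the three cubes: the group algebra is universal for N symmetries subject to
    Q, which is empty, half-commutation or commutation, and the coordinates are the rescaled
    symmetries. *)
Definition cube_presented_by (Q : forall A, ('I_N -> A) -> Prop) (X : qspace R N)
    (g : 'I_N -> X) : Prop :=
  universal_cstar (fun A v => symmetries v /\ Q A v) g /\
  forall i, scoord X i = (sqrtC (N%:R : R[i]))^-1 *: g i.

Lemma generates_sub A (G H : set A) :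
  (forall S : set A, closed_star_subalgebra S -> H `<=` S -> G `<=` S) ->
  generates G -> generates H.
Proof.
move=> sub gen; apply/seteqP; split => // x _ S [cS HS].
by have : [set: A] x by []; rewrite -gen; apply; split => //; exact: sub.
Qed.

Lemma subalgebra_scale A (S : set A) c a : closed_star_subalgebra S -> S a -> S (c *: a).
Proof.
move=> [_ S1 SL _ _] Sa; rewrite -[_ *: _]addr0; apply: (SL) => //.
by rewrite -(addNr 1) -(scaleN1r 1); exact: SL.
Qed.

Section Words.
Variables (A : cstarAlgType R) (v : 'I_N -> A).
Hypothesis v_sym : symmetries v.

Definition wprod (s : seq 'I_N) : A := \prod_(i <- s) v i.

Lemma wprod_cat s t : wprod (s ++ t) = wprod s * wprod t.
Proof. exact: big_cat. Qed.

Lemma wprod_star s : star (wprod s) = wprod (rev s).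
Proof.
elim: s => [|i s IH]; first by rewrite /wprod big_nil star1.
rewrite rev_cons -cats1 wprod_cat -IH /wprod big_cons starM (v_sym i).1.
by rewrite big_seq1.
Qed.

Lemma wprod_cong rel s t : (forall s t, rel s t -> wprod s = wprod t) ->
  word_cong rel s t -> wprod s = wprod t.
Proof.
move=> hrel; elim=> {s t} // [s t s' _ -> _ ->//|s s' t t' _ IHs _ IHt|i].
  by rewrite !wprod_cat IHs IHt.
by rewrite /wprod !big_cons big_nil mulr1 (v_sym i).2.
Qed.

Lemma word_group_rep rel : (forall s t, rel s t -> wprod s = wprod t) ->
  exists2 pi : word_group rel -> A, unitary_rep pi &
    forall i, pi (word_gen rel i) = v i.
Proof.
move=> hrel; pose pi (x : word_group rel) := wprod (repr x).
have piE s : pi (wclass rel s) = wprod s.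
  exact: wprod_cong hrel (repr_wclassP rel s).
exists pi; last by move=> i; rewrite piE /wprod big_seq1.
split=> [|g h|g].
- by rewrite piE /wprod big_nil.
- by rewrite piE wprod_cat.
- have p1 : wprod [::] = 1 by rewrite /wprod big_nil.
  rewrite wprod_star -!wprod_cat -p1; split; apply: wprod_cong hrel _.
    exact: word_cong_rev_cat.
  exact: word_cong_cat_rev.
Qed.

Lemma Z2pow_rep : commuting v -> exists2 pi : Z2pow N -> A, unitary_rep pi &
  forall i, pi (Z2pow_gen i) = v i.
Proof.
move=> vC; pose pi (x : Z2pow N) := \prod_i v i ^+ (x i : nat).
have piM g h : pi (g * h)%g = pi g * pi h.
  rewrite /pi -prodrM_comm; last first.
    by move=> i j *; apply: commrX; apply/commr_sym/commrX; exact: vC.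
  apply: eq_bigr => i _; rewrite ffunE -exprD.
  have : v i ^+ 2 = 1 by rewrite expr2 (v_sym i).2.
  (* The exponents are the representatives 0 and 1, so only 1 + 1 is reduced, and there v_i^2 = 1
     applies. *)
  by case: (g i) (h i) => [[|[|//]] ?] [[|[|//]] ?] //= ->.
have pi1 : pi 1%g = 1 by rewrite /pi big1// => i _; rewrite ffunE.
have piV g : pi g * pi g = 1.
  rewrite -piM -pi1; congr pi; apply/ffunP => i; rewrite !ffunE.
  by case: (g i) => [[|[|//]] ?]; apply/val_inj.
have piS g : star (pi g) = pi g.
  suff S s : star (\prod_(i <- s) v i ^+ (g i : nat)) = \prod_(i <- s) v i ^+ (g i : nat).
    exact: S.
  elim: s => [|i s IH]; first by rewrite !big_nil star1.
  rewrite !big_cons starM IH starX (v_sym i).1; apply/commr_sym/commr_prod => j _.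
  by apply: commrX; apply/commr_sym/commrX; exact: vC.
exists pi; first by split=> // g; rewrite piS piV.
move=> i; rewrite /pi -[RHS](big_pred1_eq *%R i v) big_mkcond; apply: eq_bigr => j _.
by rewrite ffunE; case: (j == i).
Qed.

End Words.

Lemma unitary_rep_symmetry (Gam : groupType) A (pi : Gam -> A) g :
  unitary_rep pi -> (g * g)%g = 1%g -> star (pi g) = pi g /\ pi g * pi g = 1.
Proof.
move=> [pi1 piM piU] gg; have pp : pi g * pi g = 1 by rewrite -piM gg pi1.
by split=> //; rewrite -[LHS]mulr1 -pp mulrA (piU g).1 mul1r.
Qed.

Lemma word_group_dual rel (Q : forall A, ('I_N -> A) -> Prop) (X : qspace R N) :
  (forall A (v : 'I_N -> A), Q A v <-> forall s t, rel s t -> wprod v s = wprod v t) ->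
  is_dual (word_gen rel) X -> exists g : 'I_N -> X, cube_presented_by Q g.
Proof.
move=> QE [pi [piU gen univ] xE]; have [pi1 piM _] := piU.
have gg i : (word_gen rel i * word_gen rel i)%g = 1%g.
  by rewrite [LHS]wmul_class; exact/wclass_eqP/word_cong_invol.
have wE s : pi (wclass rel s) = wprod (fun i => pi (word_gen rel i)) s.
  elim: s => [|i s IH]; first by rewrite /wprod big_nil -pi1.
  by rewrite /wprod big_cons -/(wprod _ s) -IH -piM; congr pi; rewrite [RHS]wmul_class.
exists (fun i => pi (word_gen rel i)); split => //; split.
- split=> [i|]; first exact: unitary_rep_symmetry piU (gg i).
  by apply/QE => s t st; rewrite -!wE; congr pi; exact/wclass_eqP/word_cong_rel.
- apply: generates_sub gen => S [_ S1 _ SM _] SG _ [x _ <-].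
  have [s ->] := wclass_surj x; rewrite wE; elim: s => [|i s IH].
    by rewrite /wprod big_nil.
  by rewrite /wprod big_cons; apply: SM => //; apply: SG; exists i.
- move=> B v [vS /QE vQ]; have [rho rhoU rhoE] := word_group_rep vS vQ.
  have [f fs fE] := univ B rho rhoU; exists f => // i.
  by rewrite fE rhoE.
Qed.

Lemma free_cube_presented (X : qspace R N) : is_dual (@Z2free_gen N) X ->
  exists g : 'I_N -> X, cube_presented_by (fun _ _ => True) g.
Proof. by apply: word_group_dual => A v; split. Qed.

Lemma half_cube_presented (X : qspace R N) : is_dual (@Z2half_gen N) X ->
  exists g : 'I_N -> X, cube_presented_by half_commuting g.
Proof.
apply: word_group_dual => A v; split => [vH _ _ [a [b [c [-> ->]]]]|h a b c].
  by rewrite /wprod !big_cons big_nil !mulr1 !mulrA vH.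
have := h [:: a; b; c] [:: c; b; a]; rewrite /wprod !big_cons big_nil !mulr1 !mulrA.
by apply; exists a, b, c.
Qed.

Lemma cube_presented (X : qspace R N) : is_dual (@Z2pow_gen N) X ->
  exists g : 'I_N -> X, cube_presented_by commuting g.
Proof.
move=> [pi [piU gen univ] xE]; have [pi1 piM _] := piU.
exists (fun i => pi (Z2pow_gen i)); split => //; split.
- split=> [i|a b]; first apply: unitary_rep_symmetry piU _.
    apply/ffunP => j; rewrite !ffunE; case: (j == i); exact/val_inj.
  by rewrite -!piM; congr pi; apply/ffunP => j; rewrite !ffunE; exact: addrC.
- apply: generates_sub gen => S [_ S1 _ SM _] SG _ [x _ <-].
  have -> : x = (\prod_i Z2pow_gen i ^+ (x i : nat))%g.
    apply/ffunP => j.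
    have powE (h : Z2pow N) n : (h ^+ n)%g j = (h j : 'Z_2) *+ n.
      by elim: n => [|n IH]; rewrite ?expg0 ?expgS ffunE// IH mulrS.
    have -> : (\prod_i Z2pow_gen i ^+ (x i : nat))%g j
        = \sum_i (Z2pow_gen i j : 'Z_2) *+ (x i : nat).
      apply: etrans (_ : _ = \sum_i (Z2pow_gen i ^+ (x i : nat))%g j :> 'Z_2) _.
        by apply: (big_morph (fun h : Z2pow N => h j : 'Z_2)) => [g h|]; rewrite ffunE.
      by apply: eq_bigr => i _; rewrite powE.
    rewrite (bigD1 j)//= big1 => [|i ij]; rewrite ffunE ?eqxx ?addr0 ?natr_Zp//.
    by rewrite eq_sym (negPf ij) mul0rn.
  elim/big_rec: _ => [|i y _ Sy]; first by rewrite pi1.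
  rewrite piM; apply: (SM) => //; elim: (x i : nat) => [|n IH]; first by rewrite pi1.
  by rewrite expgS piM; apply: SM => //; apply: SG; exists i.
- move=> B v [vS vC]; have [rho rhoU rhoE] := Z2pow_rep vS vC.
  have [f fs fE] := univ B rho rhoU; exists f => // i.
  by rewrite fE rhoE.
Qed.

End GroupDuals.

(** * Quantum groups presented by relations *)

(** Passes commutation from generators to the algebra they generate: the commutant of a star-stable
    set is a closed subalgebra, and its preimage is norm closed because f is contractive. *)
Lemma commutant_closed (R : realType) (A B : cstarAlgType R) (f : {lrmorphism A -> B})
    (S : set B) : star_preserving f -> (forall b, S b -> S (star b)) ->
  closed_star_subalgebra [set a | forall b, S b -> b * f a = f a * b].
Proof.
move=> fs SS; split=> [a cl b Sb|b _|c a a' ha ha' b Sb|a a' ha ha' b Sb|a ha b Sb].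
- apply/eqP; rewrite -subr_eq0; apply/eqP/cnorm_le0/ler_addgt0Pr => e e0.
  have k0 : 0 < 2 * cnorm b + 1 by rewrite ltr_wpDl// mulr_ge0// cnorm_ge0.
  have [a' ha' aa'] := cl _ (divr_gt0 e0 k0).
  have -> : b * f a - f a * b = f (a' - a) * b - b * f (a' - a).
    by rewrite raddfB mulrBl mulrBr ha'// opprB [RHS]addrC subrKA.
  move: aa'; rewrite ltr_pdivlMr// => aa'.
  have := cnormB (f (a' - a) * b) (b * f (a' - a)).
  have := cnormM (f (a' - a)) b; have := cnormM b (f (a' - a)).
  have := cnorm_morph_le fs (a' - a); have := cnorm_ge0 (a' - a); have := cnorm_ge0 b.
  by nra.
- by rewrite rmorph1 mulr1 mul1r.
- by rewrite linearP mulrDr mulrDl ha'// -scalerAr -scalerAl ha.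
- by rewrite rmorphM mulrA ha// -mulrA ha'// mulrA.
- by apply: (can_inj starK); rewrite !starM -fs starK ha//; exact: SS.
Qed.

Section QuantumGroupTools.
Variables (R : realType) (N : nat).
Implicit Types (A B : cstarAlgType R).

Lemma orthogonal_relP A (u : 'M[A]_N) : orthogonal_rel u <->
  [/\ forall i j, star (u i j) = u i j,
      forall i k, \sum_j u i j * u k j = (i == k)%:R &
      forall j l, \sum_i u i j * u i l = (j == l)%:R].
Proof.
split=> [[us uu uu']|[us uu uu']]; split.
- by move=> i j; rewrite -[in RHS]us mxE.
- move=> i k; have /matrixP/(_ i k) := uu; rewrite !mxE => <-.
  by apply: eq_bigr => j _; rewrite mxE.
- move=> j l; have /matrixP/(_ j l) := uu'; rewrite !mxE => <-.
  by apply: eq_bigr => i _; rewrite mxE.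
- by apply/matrixP => i j; rewrite mxE us.
- apply/matrixP => i k; rewrite !mxE -uu.
  by apply: eq_bigr => j _; rewrite mxE.
- apply/matrixP => j l; rewrite !mxE -uu'.
  by apply: eq_bigr => i _; rewrite mxE.
Qed.

Definition entries_commute A (m n p q : nat) (u : 'M[A]_(m, n)) (v : 'M[A]_(p, q)) : Prop :=
  forall i j k l, u i j * v k l = v k l * u i j.

Lemma mul_sumr2 A (I J : finType) (x y : I -> A) (z w : J -> A) :
  (forall i j, y i * z j = z j * y i) ->
  (\sum_i x i * y i) * (\sum_j z j * w j) = \sum_i \sum_j (x i * z j) * (y i * w j).
Proof.
move=> yz; rewrite mulr_suml; apply: eq_bigr => i _; rewrite mulr_sumr.
by apply: eq_bigr => j _; rewrite -!mulrA (mulrA (y i)) yz !mulrA.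
Qed.

Lemma orthogonal_rel_mul A (u v : 'M[A]_N) : entries_commute u v ->
  orthogonal_rel u -> orthogonal_rel v -> orthogonal_rel (u *m v).
Proof.
move=> uv /orthogonal_relP[us uu uu'] /orthogonal_relP[vs vv vv'].
apply/orthogonal_relP; split => [i j|i k|j l].
- rewrite mxE star_sum; apply: eq_bigr => k _.
  by rewrite starM us vs uv.
- under eq_bigr => j _.
    rewrite !mxE mul_sumr2; last by move=> a b; rewrite uv.
    over.
  rewrite exchange_big -uu; apply: eq_bigr => a _ /=.
  rewrite exchange_big (bigD1 a)//= -mulr_sumr vv eqxx mulr1 big1 ?addr0// => b ba.
  by rewrite -mulr_sumr vv eq_sym (negPf ba) mulr0.
- under eq_bigr => i _.
    rewrite !mxE mul_sumr2; last by move=> a b; rewrite uv.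
    over.
  rewrite exchange_big -vv'; apply: eq_bigr => a _ /=.
  rewrite exchange_big (bigD1 a)//= -mulr_suml uu' eqxx mul1r big1 ?addr0// => b ba.
  by rewrite -mulr_suml uu' eq_sym (negPf ba) mul0r.
Qed.

Lemma orthogonal_rel1 A : orthogonal_rel (1%:M : 'M[A]_N).
Proof.
split; rewrite ?trmx1 ?mulmx1//; apply/matrixP => i j; rewrite !mxE.
by case: (i == j); rewrite ?star1 ?star0.
Qed.

Lemma orthogonal_rel_map A B (f : {lrmorphism A -> B}) (u : 'M[A]_N) :
  star_preserving f -> orthogonal_rel u -> orthogonal_rel (map_mx f u).
Proof.
move=> fs /orthogonal_relP[us uu uu']; apply/orthogonal_relP.
split=> [i j|i k|j l]; first by rewrite mxE -fs us.
  rewrite -(rmorph_nat f) -uu rmorph_sum; apply: eq_bigr => j _.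
  by rewrite !mxE rmorphM.
rewrite -(rmorph_nat f) -uu' rmorph_sum; apply: eq_bigr => i _.
by rewrite !mxE rmorphM.
Qed.

(** The image of u under the antipode: the transpose, read in the opposite algebra. *)
Definition opp_trmx A (u : 'M[A]_N) : 'M[copp A]_N := \matrix_(i, j) (u j i : copp A).

Lemma orthogonal_rel_opp A (u : 'M[A]_N) :
  orthogonal_rel u -> orthogonal_rel (opp_trmx u).
Proof.
move=> /orthogonal_relP[us uu uu']; apply/orthogonal_relP.
split=> [i j|i k|j l]; first by rewrite !mxE; exact: us.
  apply: (@etrans A _ (\sum_j u j k * u j i)).
    by apply: eq_bigr => j _; rewrite !mxE.
  by rewrite uu' eq_sym; case: (i == k).
apply: (@etrans A _ (\sum_i u l i * u j i)).
  by apply: eq_bigr => i _; rewrite !mxE.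
by rewrite uu eq_sym; case: (j == l).
Qed.

Variable P : forall A, 'M[A]_N -> Prop.
Arguments P {A}.

(** The four stability properties behind a quantum subgroup: [rel_mul] gives the comultiplication,
    applied to the two legs obtained by [rel_map], [rel_opp] gives the antipode and [rel_one] the
    counit. *)
Definition rel_mul : Prop := forall A (u v : 'M[A]_N), entries_commute u v ->
  orthogonal_rel u -> orthogonal_rel v -> P u -> P v -> P (u *m v).
Definition rel_map : Prop := forall A B (f : {lrmorphism A -> B}) (u : 'M[A]_N),
  star_preserving f -> P u -> P (map_mx f u).
Definition rel_opp : Prop := forall A (u : 'M[A]_N), P u -> P (opp_trmx u).
Definition rel_one : Prop := P (1%:M : 'M[(R[i])^o]_N).

Lemma qgroup_presented_rel G : qgroup_presented_by (@P) G ->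
  orthogonal_rel (qfund G) /\ P (qfund G).
Proof.
case=> /= [[oG PG] _ _]; have e : \matrix_(i, j) qfund G i j = qfund G.
  by apply/matrixP => i j; rewrite mxE.
by rewrite e in oG PG.
Qed.

Lemma qgroup_presented_univ G B (u : 'M[B]_N) : qgroup_presented_by (@P) G ->
  orthogonal_rel u -> P u -> exists2 f : {lrmorphism G -> B}, star_preserving f &
    forall i j, f (qfund G i j) = u i j.
Proof.
move=> [_ _ univ] ou Pu; have [|f fs fE] := univ B (fun ij => u ij.1 ij.2).
  have e : \matrix_(i, j) u i j = u by apply/matrixP => i j; rewrite mxE.
  by rewrite /= e.
by exists f => // i j; exact: fE (i, j).
Qed.

Lemma qgroup_presented_counit G : rel_one -> qgroup_presented_by (@P) G ->
  exists2 eps : {lrmorphism G -> (R[i])^o}, (forall a, eps (star a) = (eps a)^*) &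
    forall i j, eps (qfund G i j) = (i == j)%:R.
Proof.
move=> P1 GP; have [f fs fE] := qgroup_presented_univ GP (orthogonal_rel1 _) P1.
by exists f => // i j; rewrite fE mxE.
Qed.

Lemma qgroup_presented_subgroup G : rel_mul -> rel_map -> rel_opp -> rel_one ->
  qgroup_presented_by (@P) G -> quantum_subgroup G.
Proof.
move=> Pmul Pmap Popp P1 GP; have [oG PG] := qgroup_presented_rel GP.
have [eps eps_star epsE] := qgroup_presented_counit P1 GP.
split=> //; first by case: GP.
(* The counit is constructed before the comultiplication, since the tensor product that receives the
   latter exists thanks to it. *)
- have [T [i1 [i2 tens]]] := @max_tensor_of_character R G G eps eps_star.
  exists T, i1, i2; split=> //; have [[i1s i2s] comm _ _] := tens.
  have uv : entries_commute (map_mx i1 (qfund G)) (map_mx i2 (qfund G)).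
    by move=> i j k l; rewrite !mxE comm.
  have [|D Ds DE] := qgroup_presented_univ GP (orthogonal_rel_mul uv
    (orthogonal_rel_map i1s oG) (orthogonal_rel_map i2s oG)).
    by apply: Pmul; rewrite //; by [exact: orthogonal_rel_map|exact: Pmap].
  by exists D => // i j; rewrite DE mxE; apply: eq_bigr => k _; rewrite !mxE.
- by exists eps.
- have [f fs fE] := qgroup_presented_univ GP (orthogonal_rel_opp oG) (Popp _ _ PG).
  (* Multiplication in [copp G] is reversed, so f, read as a map from G to itself, is linear and
     antimultiplicative. *)
  have fL : linear (f : G -> G) by move=> c a b; rewrite linearP.
  pose fLm := GRing.isLinear.Build R[i] G G _ (f : G -> G) fL.
  pose S : {linear G -> G} := HB.pack (f : G -> G) fLm.
  exists S; split => [|a b|a|i j].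
  + exact: (rmorph1 f).
  + exact: (rmorphM f a b).
  + exact: fs.
  + by rewrite /= fE mxE.
Qed.

Lemma qgroup_presented_sub G H : qgroup_presented_by (@P) G -> quantum_subgroup H ->
  P (qfund H) -> qsub H G.
Proof. by move=> GP [oH _ _ _ _] PH; exact: qgroup_presented_univ GP oH PH. Qed.

Variable Q : forall A, ('I_N -> A) -> Prop.
Arguments Q {A}.

Definition cube_rel_map : Prop := forall A B (f : {lrmorphism A -> B}) v,
  star_preserving f -> Q v -> Q (f \o v).

Definition qact A (u : 'M[A]_N) (v : 'I_N -> A) : 'I_N -> A :=
  fun i => \sum_j u i j * v j.

Lemma presented_acts G (X : qspace R N) (g : 'I_N -> X) : rel_one -> rel_map -> cube_rel_map ->
  (forall A (u : 'M[A]_N) v, (forall i j k, u i j * v k = v k * u i j) ->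
    orthogonal_rel u -> P u -> symmetries v -> Q v ->
    symmetries (qact u v) /\ Q (qact u v)) ->
  qgroup_presented_by (@P) G -> cube_presented_by (@Q) g -> acts_affinely G X.
Proof.
move=> P1 Pmap Qmap PQ GP [[[gS gQ] _ univ] xE].
have [oG PG] := qgroup_presented_rel GP.
have [eps eps_star _] := qgroup_presented_counit P1 GP.
have [T [iG [iX tens]]] := @max_tensor_of_character R G X eps eps_star.
exists T, iG, iX; split=> //; have [[iGs iXs] comm _ _] := tens.
have [||wS wQ] := PQ T (map_mx iG (qfund G)) (iX \o g) _ (orthogonal_rel_map iGs oG)
  (Pmap _ _ _ _ iGs PG) _ (Qmap _ _ _ _ iXs gQ).
- by move=> i j k; rewrite !mxE comm.
- by move=> i; have [s1 s2] := gS i; rewrite /= -iXs -rmorphM s1 s2 rmorph1.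
have [f fs fE] := univ T _ (conj wS wQ); exists f => // i.
rewrite xE linearZ/= fE scaler_sumr; apply: eq_bigr => j _.
by rewrite mxE xE linearZ /= scalerAr.
Qed.

(** By maximality of the tensor product, commuting j and v induce a morphism from it to B. After the
    coaction this morphism sends g_i to the i-th entry of [qact], which therefore inherits the
    relations of the g_i. *)
Lemma acts_transfer (H : qmatrix R N) (X : qspace R N) (g : 'I_N -> X) B
    (j : {lrmorphism H -> B}) (v : 'I_N -> B) : (0 < N)%N ->
  cube_rel_map -> acts_affinely H X -> cube_presented_by (@Q) g -> star_preserving j ->
  (forall a k, j a * v k = v k * j a) -> symmetries v -> Q v ->
  symmetries (qact (map_mx j (qfund H)) v) /\ Q (qact (map_mx j (qfund H)) v).
Proof.
move=> N0 Qmap [T [iH [iX [tens [Phi Phis PhiE]]]]] [[[gS gQ] gen univ] xE] js jv vS vQ.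
have [f0 f0s f0E] := univ B v (conj vS vQ).
have comm a x : j a * f0 x = f0 x * j a.
  suff : [set x | forall b, range j b -> b * f0 x = f0 x * b] x by apply; exists a.
  have : [set: X] x by []; rewrite -gen; apply; split.
    by apply: commutant_closed f0s _ => _ [a' _ <-]; exists (star a').
  by move=> _ [i _ <-] _ [a' _ <-]; rewrite f0E.
have [_ _ _ /(_ B j f0 js f0s comm)[f fs [fH fX]]] := tens.
(* The coordinates are g_i / sqrt N; this common factor is cancelled below, which needs N > 0. *)
have s0 : sqrtC (N%:R : R[i]) != 0 by rewrite sqrtC_eq0 pnatr_eq0 -lt0n.
have wE i : f (Phi (g i)) = qact (map_mx j (qfund H)) v i.
  apply: (scalerI (invr_neq0 s0)); rewrite -!linearZ/= -xE PhiE rmorph_sum/=.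
  rewrite scaler_sumr; apply: eq_bigr => k _.
  by rewrite rmorphM/= fH fX xE linearZ/= f0E mxE scalerAr.
have wF : qact (map_mx j (qfund H)) v = f \o (Phi \o g) by apply/funext => i /=.
rewrite wF; split; last exact/Qmap/Qmap.
by move=> i; have [s1 s2] := gS i; rewrite /= -fs -Phis -!rmorphM s1 s2 !rmorph1.
Qed.

End QuantumGroupTools.

(** * Stability of the relations under the structure maps and the coactions *)

Section Relations.
Variables (R : realType) (N : nat).
Implicit Types (A B : cstarAlgType R).

Section Action.
Variables (A : cstarAlgType R) (u : 'M[A]_N).
Definition commutes_with (y : 'I_N -> A) := forall i b a, y a * u i b = u i b * y a.

Lemma qactM2 y z i k : commutes_with y ->
  qact u y i * qact u z k = \sum_a \sum_b (u i a * u k b) * (y a * z b).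
Proof. by move=> yu; rewrite mul_sumr2. Qed.

Lemma qactM3 y z w i k p : commutes_with y -> commutes_with z ->
  qact u y i * qact u z k * qact u w p =
  \sum_a \sum_b \sum_c (u i a * u k b * u p c) * (y a * z b * w c).
Proof.
move=> yu zu; rewrite qactM2// mulr_suml; apply: eq_bigr => a _.
rewrite mulr_suml; apply: eq_bigr => b _; rewrite mulr_sumr; apply: eq_bigr => c _.
by rewrite -!mulrA (mulrA (z b)) zu !mulrA -(mulrA _ (y a)) yu !mulrA.
Qed.

End Action.

(** A column of a product is the action on a column, so the same expansions serve for coproducts and
    coactions. *)
Lemma mulmx_qact A (u v : 'M[A]_N) i j : (u *m v) i j = qact u (v^~ j) i.
Proof. by rewrite mxE. Qed.

Lemma entries_commute_with A (u v : 'M[A]_N) j : entries_commute u v ->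
  commutes_with u (v^~ j).
Proof. by move=> uv i b a; rewrite uv. Qed.

Lemma addr_self_eq0 A (x : A) : x + x = 0 -> x = 0.
Proof.
move=> /eqP; rewrite -mulr2n -scaler_nat scaler_eq0 => /orP[|/eqP//].
by rewrite pnatr_eq0.
Qed.

Lemma exchange_big3 A (F : 'I_N -> 'I_N -> 'I_N -> A) :
  \sum_a \sum_b \sum_c F a b c = \sum_c \sum_b \sum_a F a b c.
Proof.
rewrite exchange_big; under eq_bigr do rewrite exchange_big.
exact: exchange_big.
Qed.

(** The off-diagonal part is its own opposite once the indices are exchanged, and 2 is
    invertible. *)
Lemma antisymmetric_sum A (F : 'I_N -> 'I_N -> A) :
  (forall a b, a != b -> F a b = - F b a) -> \sum_a \sum_b F a b = \sum_a F a a.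
Proof.
move=> anti; pose D a b := if a == b then F a a else 0.
have -> : \sum_a F a a = \sum_a \sum_b D a b.
  apply: eq_bigr => a _; rewrite (bigD1 a)//= /D eqxx big1 ?addr0// => b ba.
  by rewrite eq_sym (negPf ba).
apply/eqP; rewrite -subr_eq0 -sumrB; under eq_bigr do rewrite -sumrB.
apply/eqP/addr_self_eq0; rewrite {1}exchange_big -big_split big1// => a _.
rewrite -big_split big1// => b _; rewrite /D (eq_sym b).
by have [->|ab] := eqVneq a b; rewrite /= ?subrr ?addr0// !subr0 (anti a)// subrr.
Qed.

Lemma Hplus_mul : rel_mul (@Hplus_rel R N).
Proof.
move=> A u v uv _ _ [ur uc] [vr vc]; split=> i j k jk; rewrite !mulmx_qact qactM2;
  try exact: entries_commute_with; rewrite big1// => a _; rewrite big1// => b _;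
  have [->|ab] := eqVneq a b.
- by rewrite vr ?mulr0.
- by rewrite ur ?mul0r.
- by rewrite uc ?mul0r.
- by rewrite vc ?mulr0.
Qed.

Lemma Hplus_map : rel_map (@Hplus_rel R N).
Proof.
by move=> A B f u _ [ur uc]; split=> i j k jk; rewrite !mxE -rmorphM ?ur ?uc ?rmorph0.
Qed.

Lemma Hplus_opp : rel_opp (@Hplus_rel R N).
Proof.
move=> A u [ur uc]; split=> i j k jk; rewrite !mxE copp_mulE.
  by rewrite uc// eq_sym.
by rewrite ur// eq_sym.
Qed.

Lemma Hplus_one : rel_one (@Hplus_rel R N).
Proof.
split=> i j k jk; rewrite !mxE.
  by have [->|] := eqVneq i j; [rewrite (negPf jk) mulr0|rewrite mul0r].
by have [<-|] := eqVneq i k; [rewrite eq_sym (negPf jk) mulr0|rewrite mul0r].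
Qed.

Lemma Hstar_mul : rel_mul (@Hstar_rel R N).
Proof.
move=> A u v uv ou ov [uH uh] [vH vh]; split; first exact: Hplus_mul.
move=> i j k l p q; rewrite !mulmx_qact !qactM3; try exact: entries_commute_with.
rewrite exchange_big3; do 3!apply: eq_bigr => ? _.
by rewrite uh vh.
Qed.

Lemma Hstar_map : rel_map (@Hstar_rel R N).
Proof.
move=> A B f u fs [uH uh]; split; first exact: Hplus_map.
by move=> i j k l p q; rewrite !mxE -!rmorphM uh.
Qed.

Lemma Hstar_opp : rel_opp (@Hstar_rel R N).
Proof.
move=> A u [uH uh]; split; first exact: Hplus_opp.
by move=> i j k l p q; rewrite !mxE !copp_mulE !mulrA uh.
Qed.

Lemma Hstar_one : rel_one (@Hstar_rel R N).
Proof.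
split; first exact: Hplus_one.
by move=> i j k l p q; rewrite mulrC mulrA mulrAC.
Qed.

(** Signs multiply termwise, according to whether the summation indices a and b agree. On a common
    row or column exactly one of the two factors contributes a sign; for distinct rows and columns
    both do when a = b, and neither does otherwise. *)
Lemma barO_mul : rel_mul (@barO_rel R N).
Proof.
move=> A u v uv _ _ [ur uc ux] [vr vc vx].
have uvj j := entries_commute_with j uv.
split=> [i j l jl|i k j ik|i j k l ik jl]; rewrite !mulmx_qact !qactM2//.
- rewrite [in RHS]exchange_big -sumrN; apply: eq_bigr => a _.
  rewrite -sumrN; apply: eq_bigr => b _; have [->|ab] := eqVneq a b.
    by rewrite vr// mulrN.
  by rewrite ur// (vx a j b l)// mulNr.
- rewrite [in RHS]exchange_big -sumrN; apply: eq_bigr => a _.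
  rewrite -sumrN; apply: eq_bigr => b _; have [->|ab] := eqVneq a b.
    by rewrite uc// mulNr.
  by rewrite vc// (ux i a k b)// mulrN.
- rewrite [in RHS]exchange_big; apply: eq_bigr => a _; apply: eq_bigr => b _.
  have [->|ab] := eqVneq a b; first by rewrite uc// vr// mulrNN.
  by rewrite ux// vx.
Qed.

Lemma barO_map : rel_map (@barO_rel R N).
Proof.
move=> A B f u _ [ur uc ux]; split=> *; rewrite !mxE -!rmorphM.
- by rewrite ur// rmorphN.
- by rewrite uc// rmorphN.
- by rewrite ux.
Qed.

Lemma barO_opp : rel_opp (@barO_rel R N).
Proof.
move=> A u [ur uc ux]; split=> [i j l jl|i k j ik|i j k l ik jl]; rewrite !mxE !copp_mulE.
- by rewrite uc// eq_sym.
- by rewrite ur// eq_sym.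
- by rewrite ux// eq_sym.
Qed.

Lemma barO_one : rel_one (@barO_rel R N).
Proof.
split=> [i j l jl|i k j ik|i j k l ik jl]; rewrite !mxE; last exact: mulrC.
  by have [->|] := eqVneq i j; rewrite ?(negPf jl) !(mulr0, mul0r) oppr0.
by have [<-|] := eqVneq i j; rewrite ?[k == i]eq_sym ?(negPf ik) !(mulr0, mul0r) oppr0.
Qed.

Section ActionRelations.
Variables (A : cstarAlgType R) (u : 'M[A]_N) (v : 'I_N -> A).
Hypotheses (uv : forall i j k, u i j * v k = v k * u i j).
Hypotheses (uO : orthogonal_rel u) (vS : symmetries v).

Lemma qact_star i : star (qact u v i) = qact u v i.
Proof.
have /orthogonal_relP[us _ _] := uO.
by rewrite star_sum; apply: eq_bigr => j _; rewrite starM (vS j).1 us uv.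
Qed.

Let vu : commutes_with u v. Proof. by move=> i b a; rewrite uv. Qed.

(** The hypothesis cancels the off-diagonal terms in pairs; as v_a^2 = 1, the diagonal ones add up
    to a diagonal entry of u u^T. *)
Lemma qact_sq i :
  (forall a b, a != b -> u i a * u i b * (v a * v b) = - (u i b * u i a * (v b * v a))) ->
  qact u v i * qact u v i = 1.
Proof.
move=> anti; rewrite qactM2// antisymmetric_sum//.
have /orthogonal_relP[_ uu _] := uO.
rewrite (eq_bigr (fun a => u i a * u i a)) ?uu ?eqxx// => a _.
by rewrite (vS a).2 mulr1.
Qed.

Lemma Hplus_symmetries : Hplus_rel u -> symmetries (qact u v).
Proof.
move=> [ur _] i; split; first exact: qact_star.
by apply: qact_sq => a b ab; rewrite !ur ?mul0r ?oppr0// eq_sym.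
Qed.

Lemma Hstar_half : Hstar_rel u -> half_commuting v -> half_commuting (qact u v).
Proof.
move=> [_ uh] vh i j k; rewrite !qactM3// exchange_big3.
by do 3!apply: eq_bigr => ? _; rewrite uh vh.
Qed.

Lemma barO_symmetries : barO_rel u -> commuting v -> symmetries (qact u v).
Proof.
move=> [ur _ _] vC i; split; first exact: qact_star.
by apply: qact_sq => a b ab; rewrite ur// mulNr (vC a).
Qed.

(** The off-diagonal terms of the commutator vanish, since there both the entries of u and the v_a
    commute. The diagonal ones add up to a difference of two off-diagonal entries of u u^T, both
    zero. *)
Lemma barO_commuting : barO_rel u -> commuting v -> commuting (qact u v).
Proof.
move=> [_ _ ux] vC i k; have [->//|ik] := eqVneq i k.
apply/eqP; rewrite -subr_eq0; apply/eqP; rewrite !qactM2//.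
rewrite [X in _ - X]exchange_big -sumrB; under eq_bigr do rewrite -sumrB.
rewrite antisymmetric_sum => [|a b ab]; last first.
  by rewrite !(ux i _ k)// ?(vC a b) ?subrr ?oppr0// eq_sym.
under eq_bigr do rewrite (vS _).2 !mulr1.
have /orthogonal_relP[_ uu _] := uO.
by rewrite sumrB !uu (eq_sym k) (negPf ik) subrr.
Qed.

End ActionRelations.

End Relations.

(** * Maximality *)

Section PermutationMatrices.
Variables (R : realType) (A : cstarAlgType R) (n : nat).
Implicit Types (f g : 'I_n.+1 -> 'I_n.+1).

(** The entry at s, t tells whether f moves s to t, so a product follows a path from left to right
    and composes the maps in the reverse order. *)
Definition pmx f : cmx A n := \matrix_(s, t) (f s == t)%:R.

Definition cmx_scalar (a : A) : cmx A n := \matrix_(s, t) (a *+ (s == t)).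

Lemma pmxE f s t : pmx f s t = (f s == t)%:R. Proof. exact: mxE. Qed.

Lemma pmx_mul f g : pmx f * pmx g = pmx (g \o f).
Proof.
apply/matrixP => s t; rewrite !mxE (bigD1 (f s))//= !mxE eqxx mul1r big1 ?addr0// => r rs.
by rewrite mxE eq_sym (negPf rs) mul0r.
Qed.

Lemma pmx_id : pmx id = 1.
Proof. by apply/matrixP => s t; rewrite !mxE. Qed.

Lemma eq_pmx f g : f =1 g -> pmx f = pmx g.
Proof. by move=> fg; apply/matrixP => s t; rewrite !mxE fg. Qed.

Lemma pmx_star f : involutive f -> star (pmx f) = pmx f.
Proof.
move=> ff; apply/matrixP => s t; rewrite !mxE eq_sym (can2_eq ff ff).
by case: (_ == _); rewrite ?star1 ?star0.
Qed.

Lemma pmx_symmetries N (s : 'I_N -> 'I_n.+1 -> 'I_n.+1) :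
  (forall i, involutive (s i)) -> symmetries (pmx \o s).
Proof.
move=> ss i; split; first exact: pmx_star (ss i).
by rewrite /= pmx_mul -pmx_id; exact: eq_pmx (ss i).
Qed.

Lemma cmx_scalar_morphism : exists2 j : {lrmorphism A -> cmx A n}, star_preserving j &
  forall a, j a = cmx_scalar a.
Proof.
have [|||j jE] := @lrmorphism_of R A (cmx A n) cmx_scalar.
- by move=> c a b; apply/matrixP => s t; rewrite !mxE mulrnDl scalerMnr.
- by apply/matrixP => s t; rewrite !mxE.
- move=> a b; apply/matrixP => s t; rewrite !mxE (bigD1 s)//= !mxE eqxx mulr1n.
  rewrite mulrnAr big1 ?addr0// => r rs; rewrite mxE eq_sym (negPf rs) mulr0n mul0r//.
exists j => // a; rewrite !jE; apply/matrixP => s t; rewrite !mxE eq_sym.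
by case: (_ == _); rewrite ?mulr1n// ?mulr0n star0.
Qed.

Lemma cmx_scalar_comm a f : cmx_scalar a * pmx f = pmx f * cmx_scalar a.
Proof.
apply/matrixP => s t; rewrite !mxE (bigD1 s)//= [RHS](bigD1 (f s))//= !mxE !eqxx.
rewrite !big1 ?addr0 => [|r rs|r rs]; rewrite ?mxE.
- by rewrite mulr1n mul1r mulr_natr.
- by rewrite eq_sym (negPf rs) mul0r.
- by rewrite eq_sym (negPf rs) mulr0n mul0r.
Qed.

Lemma cmx_scalar_mul a b : cmx_scalar a * cmx_scalar b = cmx_scalar (a * b).
Proof.
have [j _ jE] := cmx_scalar_morphism; by rewrite -!jE rmorphM.
Qed.

Lemma cmx_scalar_pmxE a f s t : (cmx_scalar a * pmx f : cmx A n) s t = a *+ (f s == t).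
Proof.
rewrite mxE (bigD1 s)//= !mxE eqxx mulr1n mulr_natr big1 ?addr0// => r rs.
by rewrite mxE eq_sym (negPf rs) mulr0n mul0r.
Qed.

End PermutationMatrices.

Section Maximality.
Variables (R : realType) (N : nat).
Hypothesis N_gt0 : (0 < N)%N.
Variable H : qmatrix R N.
Hypothesis HS : quantum_subgroup H.
Local Notation u := (qfund H).

Definition qperm n (s : 'I_N -> 'I_n.+1 -> 'I_n.+1) (i : 'I_N) : cmx H n :=
  \sum_p cmx_scalar n (u i p) * pmx H (s p).

Lemma acts_qperm (Q : forall A : cstarAlgType R, ('I_N -> A) -> Prop)
    (X : qspace R N) (g : 'I_N -> X) n (s : 'I_N -> 'I_n.+1 -> 'I_n.+1) :
  cube_rel_map Q -> cube_presented_by Q g -> acts_affinely H X ->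
  (forall i, involutive (s i)) -> Q _ (pmx H (n := n) \o s) ->
  symmetries (qperm s) /\ Q _ (qperm s).
Proof.
move=> Qmap gP HX ss sQ; have [j js jE] := cmx_scalar_morphism H n.
have := acts_transfer N_gt0 Qmap HX gP js _ (pmx_symmetries H ss) sQ.
have -> : qact (map_mx j u) (pmx H (n := n) \o s) = qperm s.
  by apply/funext => i; apply: eq_bigr => p _; rewrite mxE jE.
by apply=> a k; rewrite jE cmx_scalar_comm.
Qed.

Lemma qpermM2 n (s : 'I_N -> 'I_n.+1 -> 'I_n.+1) i k x y :
  (qperm s i * qperm s k : cmx H n) x y =
  \sum_p \sum_q (u i p * u k q) *+ (s q (s p x) == y).
Proof.
rewrite mul_sumr2 => [|p q]; last by rewrite cmx_scalar_comm.
rewrite summxE; apply: eq_bigr => p _; rewrite summxE; apply: eq_bigr => q _.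
by rewrite pmx_mul cmx_scalar_mul cmx_scalar_pmxE.
Qed.

Lemma qpermM3 n (s : 'I_N -> 'I_n.+1 -> 'I_n.+1) i k l x y :
  (qperm s i * qperm s k * qperm s l : cmx H n) x y =
  \sum_p \sum_q \sum_r (u i p * u k q * u l r) *+ (s r (s q (s p x)) == y).
Proof.
rewrite mul_sumr2 => [|p q]; last by rewrite cmx_scalar_comm.
rewrite mulr_suml summxE; apply: eq_bigr => p _.
rewrite mulr_suml summxE; apply: eq_bigr => q _.
rewrite mulr_sumr summxE; apply: eq_bigr => r _.
rewrite pmx_mul cmx_scalar_mul mulrA -(mulrA _ (pmx _ _)) -cmx_scalar_comm mulrA.
by rewrite cmx_scalar_mul -mulrA pmx_mul cmx_scalar_pmxE.
Qed.

Lemma sum2_single (F : 'I_N -> 'I_N -> H) (c : 'I_N -> 'I_N -> bool) a b :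
  (forall p q, c p q = (p == a) && (q == b)) ->
  \sum_p \sum_q F p q *+ c p q = F a b.
Proof.
move=> cE; rewrite (bigD1 a)//= (bigD1 b)//= cE !eqxx mulr1n !big1 ?addr0//.
  by move=> p pa; rewrite big1// => q _; rewrite cE (negPf pa).
by move=> q qb; rewrite cE (negPf qb) andbF.
Qed.

Lemma sum2_pair (F : 'I_N -> 'I_N -> H) (c : 'I_N -> 'I_N -> bool) a b : a != b ->
  (forall p q, c p q = (p == a) && (q == b) || (p == b) && (q == a)) ->
  \sum_p \sum_q F p q *+ c p q = F a b + F b a.
Proof.
move=> ab cE.
rewrite -(@sum2_single F (fun p q => (p == a) && (q == b)) a b)//.
rewrite -(@sum2_single F (fun p q => (p == b) && (q == a)) b a)//.
rewrite -big_split; apply: eq_bigr => p _; rewrite -big_split; apply: eq_bigr => q _.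
rewrite /= cE -mulrnDr; congr (_ *+ _).
have [->|] := eqVneq p a; last by rewrite orFb add0n.
by rewrite (negPf ab) /= orbF addn0.
Qed.

Lemma sum3_single (F : 'I_N -> 'I_N -> 'I_N -> H) (c : 'I_N -> 'I_N -> 'I_N -> bool) a b d :
  (forall p q r, c p q r = [&& p == a, q == b & r == d]) ->
  \sum_p \sum_q \sum_r F p q r *+ c p q r = F a b d.
Proof.
move=> cE; rewrite (bigD1 a)//= (bigD1 b)//= (bigD1 d)//= cE !eqxx mulr1n !big1 ?addr0//.
- by move=> p pa; rewrite big1// => q _; rewrite big1// => r _; rewrite cE (negPf pa).
- by move=> q qb; rewrite big1// => r _; rewrite cE (negPf qb) andbF.
- by move=> r rd; rewrite cE (negPf rd) !andbF.
Qed.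

Lemma sum3_pair (F : 'I_N -> 'I_N -> 'I_N -> H) (c : 'I_N -> 'I_N -> 'I_N -> bool) a b d :
  a != d ->
  (forall p q r, c p q r = [&& p == a, q == b & r == d] || [&& p == d, q == b & r == a]) ->
  \sum_p \sum_q \sum_r F p q r *+ c p q r = F a b d + F d b a.
Proof.
move=> ad cE.
rewrite -(@sum3_single F (fun p q r => [&& p == a, q == b & r == d]) a b d)//.
rewrite -(@sum3_single F (fun p q r => [&& p == d, q == b & r == a]) d b a)//.
rewrite -big_split; apply: eq_bigr => p _; rewrite -big_split; apply: eq_bigr => q _.
rewrite -big_split; apply: eq_bigr => r _; rewrite /= cE -mulrnDr; congr (_ *+ _).
have [->|] := eqVneq p a; last by rewrite orFb add0n.
by rewrite (negPf ad) /= orbF addn0.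
Qed.

Lemma antipode_rel : exists S : {linear H -> H},
  (forall a b, S (a * b) = S b * S a) /\ forall i j, S (u i j) = u j i.
Proof. by case: HS => _ _ _ _ [S [_ SM _ SE]]; exists S. Qed.

(* Reflections half-commute. The weights [d] below are such that only the wanted
   indices lead from 0 to a certain point of Z/12, so that the matrix entry at
   that point isolates their coefficient. *)
Definition reflection (d : 'I_N -> 'Z_12) (p : 'I_N) (x : 'Z_12) : 'Z_12 := d p - x.

Lemma reflectionK d p : involutive (reflection d p).
Proof. by move=> x; rewrite /reflection subKr. Qed.

Lemma reflection_half d : half_commuting (pmx H (n := 11) \o reflection d).
Proof.
move=> a b c; rewrite /= !pmx_mul; apply: eq_pmx => x /=; rewrite /reflection.
by ring.
Qed.

Lemma row_products_eq0 : (forall d, symmetries (qperm (n := 11) (reflection d))) ->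
  forall i j k, j != k -> u i j * u i k = 0.
Proof.
(* Reflecting by p, then by q, translates by d_q - d_p. Among the differences of 0, 1 and 3 modulo
   12 only 3 - 1 equals 2, and the entry of the identity at (0, 2) is zero. *)
move=> sym i j k jk; pose d p : 'Z_12 := if p == j then 1 else if p == k then 3%:R else 0.
have /matrixP/(_ ord0 (inord 2)) := (sym d i).2.
rewrite qpermM2 (@sum2_single (fun p q => u i p * u i q) _ j k) => [->|p q].
  by rewrite mxE -val_eqE /= inordK.
rewrite /reflection /d -val_eqE /= inordK//.
have [_|_] := eqVneq p j; have [->|_] := eqVneq q j; rewrite /= ?(negPf jk).
- by [].
- by case: (q == k).
- by case: (p == k).
- by case: (p == k); case: (q == k).
Qed.

Lemma column_products_eq0 : (forall i j k, j != k -> u i j * u i k = 0) ->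
  forall i k j, i != k -> u i j * u k j = 0.
Proof.
move=> row i k j ik; have [S [SM SE]] := antipode_rel.
rewrite -(SE j i) -(SE j k) -SM row ?raddf0// eq_sym; exact: ik.
Qed.

Lemma reflection_triple : (forall d, half_commuting (qperm (n := 11) (reflection d))) ->
  forall i j k a b c, a != c -> b != a -> b != c ->
  u i a * u j b * u k c + u i c * u j b * u k a =
  u k a * u j b * u i c + u k c * u j b * u i a.
Proof.
move=> half i j k a b c ac ba bc.
(* Only four kinds of indices matter, which turns the condition on paths into a finite check over
   4^3 triples. *)
pose code p := if p == a then 0 else if p == b then 1 else if p == c then 2 else 3%N.
have code_lt p : code p \in iota 0 4 by rewrite /code; do 3![case: ifP => _//].
have codeP p : [/\ (p == a) = (code p == 0), (p == b) = (code p == 1)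
    & (p == c) = (code p == 2)]%N.
  rewrite /code; have [->|_] := eqVneq p a.
    by rewrite [a == b]eq_sym (negPf ba) (negPf ac).
  have [->|_] := eqVneq p b; first by rewrite (negPf bc).
  by case: (p == c).
(* Three reflections move 0 to d_p - d_q + d_r, here 1 - 6 + 2 = 9 modulo 12 for the path a, b, c.
   The reversed path has the same endpoint for any weights. Indices of the fourth kind get the
   default weight 0. *)
pose d p : 'Z_12 := nth 0 [:: 1; 6%:R; 2%:R] (code p).
have path : all (fun x => all (fun y => all (fun z =>
    let D := nth (0 : 'Z_12) [:: 1; 6%:R; 2%:R] in
    (D z - (D y - (D x - 0)) == 9%:R) == ([&& x == 0, y == 1 & z == 2] ||
      [&& x == 2, y == 1 & z == 0])%N) (iota 0 4)) (iota 0 4)) (iota 0 4).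
  by vm_compute.
have cE p q r : (reflection d r (reflection d q (reflection d p 0)) == 9%:R) =
    [&& p == a, q == b & r == c] || [&& p == c, q == b & r == a].
  have [-> _ ->] := codeP p; have [_ -> _] := codeP q; have [-> _ ->] := codeP r.
  by have /allP/(_ _ (code_lt p))/allP/(_ _ (code_lt q))/allP/(_ _ (code_lt r))/eqP := path.
have /matrixP/(_ 0 9%:R) := half d i j k; rewrite !qpermM3.
by rewrite !(sum3_pair _ ac cE).
Qed.

Lemma reflection_pair : (forall d, half_commuting (qperm (n := 11) (reflection d))) ->
  forall i j k a b, b != a -> u i a * u j b * u k a = u k a * u j b * u i a.
Proof.
move=> half i j k a b ba.
(* The path a, b, a leads from 0 to 1 - 6 + 1 = 8 modulo 12; being its own reverse, it can be
   isolated alone. *)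
pose d p : 'Z_12 := if p == a then 1 else if p == b then 6%:R else 0.
have cE p q r : (reflection d r (reflection d q (reflection d p 0)) == 8%:R) =
    [&& p == a, q == b & r == a].
  rewrite /reflection /d -val_eqE.
  have [_|_] := eqVneq p a; have [->|_] := eqVneq q a; have [_|_] := eqVneq r a;
  rewrite ?[a == b]eq_sym ?(negPf ba) => //;
  case: (p == b) => //; case: (q == b) => //; case: (r == b) => //.
have /matrixP/(_ 0 8%:R) := half d i j k; rewrite !qpermM3.
by rewrite !(sum3_single _ cE).
Qed.

(** * Half-commutation of the entries of u *)

Section HalfCommutation.
Hypothesis row : forall i j k, j != k -> u i j * u i k = 0.
Hypothesis half : forall d, half_commuting (qperm (n := 11) (reflection d)).
Let col : forall i k j, i != k -> u i j * u k j = 0 := column_products_eq0 row.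

(** Multiplying u_ia by the sum of the u_ib^2, which is 1, leaves only the term b = a. *)
Lemma qfund_cube i a : u i a * u i a * u i a = u i a.
Proof.
have [/orthogonal_relP[_ uu _] _ _ _ _] := HS.
rewrite -[RHS]mulr1 -[1]/(true%:R) -(eqxx i) -uu mulr_sumr (bigD1 a)//= mulrA.
by rewrite big1 ?addr0// => b ba; rewrite mulrA row ?mul0r// eq_sym.
Qed.

Lemma column_triple_eq0 i j k a b : i != k -> u i a * u j b * u k a = 0.
Proof.
move=> ik; have [->|ba] := eqVneq b a.
  have [->|ji] := eqVneq j i; first by rewrite -mulrA col ?mulr0.
  by rewrite col ?mul0r// eq_sym.
(* Write u_ia as its cube and exchange the outer factors of u_ia u_jb u_ka: the product u_ia u_ka
   then appears, and it vanishes. *)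
rewrite -qfund_cube -!mulrA (mulrA _ (u j b)) reflection_pair// -!mulrA.
by rewrite (mulrA (u i a) (u k a)) col// mul0r mulr0.
Qed.

Lemma row_triple_eq0 i j a b c : a != c -> u i a * u j b * u i c = 0.
Proof.
move=> ac; have [S [SM SE]] := antipode_rel.
by rewrite -(SE a i) -(SE b j) -(SE c i) -!SM mulrA column_triple_eq0 ?raddf0// eq_sym.
Qed.

(** Both sides equal u_ia^2 u_kc u_ia^2: in the sum of the u_ib^2 inserted on either end, a term
    with b different from a contains a vanishing triple product with outer factors u_ia and u_ib. *)
Lemma qfund_sq_comm i k a c : a != c -> i != k ->
  u i a * u i a * u k c = u k c * (u i a * u i a).
Proof.
move=> ac ik; have [/orthogonal_relP[_ uu _] _ _ _ _] := HS.
have one : \sum_b u i b * u i b = 1 by rewrite uu eqxx.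
transitivity (u i a * u i a * u k c * (u i a * u i a)).
  rewrite -[LHS]mulr1 -one mulr_sumr (bigD1 a)//= big1 ?addr0// => b ba.
  rewrite -!mulrA (mulrA (u k c)) (mulrA (u i a) (u k c * _)).
  by rewrite (mulrA (u i a) (u k c)) row_triple_eq0 ?mul0r ?mulr0// eq_sym.
rewrite -[RHS]mul1r -one mulr_suml (bigD1 a)//= big1 ?addr0 ?mulrA// => b ba.
rewrite -!mulrA (mulrA (u k c)) (mulrA (u i b) (u k c * _)).
by rewrite (mulrA (u i b) (u k c)) row_triple_eq0 ?mul0r ?mulr0.
Qed.

Lemma qfund_half_commute i j k a b c :
  u i a * u j b * u k c = u k c * u j b * u i a.
Proof.
have [->|ik] := eqVneq i k.
  have [->//|ac] := eqVneq a c.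
  by rewrite !row_triple_eq0// eq_sym.
have [->|ac] := eqVneq a c; first by rewrite !column_triple_eq0// eq_sym.
have [->|ba] := eqVneq b a.
  have [->|ji] := eqVneq j i; first by rewrite qfund_sq_comm// mulrA.
  by rewrite col 1?eq_sym// mul0r -mulrA col// mulr0.
have [->|bc] := eqVneq b c.
  have [->|jk] := eqVneq j k; last by rewrite -mulrA col// mulr0 col ?mul0r// eq_sym.
  by rewrite -mulrA -qfund_sq_comm// eq_sym.
have [->|ji] := eqVneq j i.
  by rewrite row 1?eq_sym// mul0r -mulrA row// mulr0.
(* Right multiplication by u_ia^2 separates the four terms of [reflection_triple]: it fixes the two
   wanted products and kills the two that end with u_ka or u_ic. *)
have sq : u i a * u j b * u k c * (u i a * u i a) = u i a * u j b * u k c.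
  rewrite -mulrA -qfund_sq_comm// mulrA -(mulrA (u i a)) -qfund_sq_comm 1?eq_sym//.
  by rewrite !mulrA qfund_cube.
have z1 : u k a * (u i a * u i a) = 0 by rewrite mulrA col ?mul0r// eq_sym.
have z2 : u i c * (u i a * u i a) = 0 by rewrite mulrA row ?mul0r// eq_sym.
have := congr1 (fun x => x * (u i a * u i a)) (reflection_triple half i j k ac ba bc).
rewrite !mulrDl sq -!(mulrA _ _ (u i a * u i a)) z1 z2 !mulr0 addr0 add0r.
by rewrite (mulrA (u i a)) qfund_cube.
Qed.

End HalfCommutation.

(** * Anticommutation and commutation of entries for the classical cube *)

Section Anticommutation.

(* Two commuting reflections, the other indices acting trivially: both [j, l] and
   [l, j] lead from 1 to 5, and no other pair does. *)
Definition klein (j l p : 'I_N) (x : 'Z_8) : 'Z_8 :=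
  if p == j then - x else if p == l then 4%:R - x else x.

Lemma kleinK j l p : involutive (klein j l p).
Proof.
move=> x; rewrite /klein; case: (p == j); first exact: opprK.
by case: (p == l); first exact: subKr.
Qed.

Lemma klein_commuting j l : commuting (pmx H (n := 7) \o klein j l).
Proof.
have e4 : - 4%:R = 4%:R :> 'Z_8 by apply/val_inj.
move=> p q; rewrite /= !pmx_mul; apply: eq_pmx => x /=; rewrite /klein.
case: (p == j); case: (q == j); case: (p == l); case: (q == l) => //;
  by rewrite opprB opprK addrC e4.
Qed.

Lemma klein_path j l p q : j != l -> (klein j l q (klein j l p 1) == 5%:R) =
  (p == j) && (q == l) || (p == l) && (q == j).
Proof.
move=> jl; rewrite /klein -val_eqE.
have [->|_] := eqVneq p j; have [->|_] := eqVneq q j; rewrite ?eqxx ?(negPf jl).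
- by [].
- by case: (q == l).
- by case: (p == l).
- by case: (p == l); case: (q == l).
Qed.

Hypothesis sym : forall j l, symmetries (qperm (n := 7) (klein j l)).
Hypothesis comm : forall j l, commuting (qperm (n := 7) (klein j l)).

Lemma row_anticommute i j l : j != l -> u i j * u i l = - (u i l * u i j).
Proof.
move=> jl; have /matrixP/(_ 1 5%:R) := (sym j l i).2.
rewrite qpermM2 (sum2_pair _ jl (fun p q => klein_path p q jl)).
rewrite mxE -val_eqE /= => /eqP; rewrite addr_eq0 => /eqP.
exact.
Qed.

Lemma cross_commutator i k j l : j != l ->
  u i j * u k l + u i l * u k j = u k j * u i l + u k l * u i j.
Proof.
move=> jl; have /matrixP/(_ 1 5%:R) := comm j l i k.
by rewrite !qpermM2 !(sum2_pair _ jl (fun p q => klein_path p q jl)).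
Qed.

Lemma column_anticommute i k j : i != k -> u i j * u k j = - (u k j * u i j).
Proof.
move=> ik; have [S [SM SE]] := antipode_rel.
by rewrite -(SE j i) -(SE j k) -!SM row_anticommute ?raddfN// eq_sym.
Qed.

(** The cross relation says that [u_ij, u_kl] = [u_kj, u_il]. The antipode applied to its transposed
    form gives [u_kl, u_ij] = [u_kj, u_il], so [u_ij, u_kl] equals its own opposite. *)
Lemma distinct_commute i j k l : i != k -> j != l -> u i j * u k l = u k l * u i j.
Proof.
move=> ik jl; have [S [SM SE]] := antipode_rel.
have e1 := cross_commutator i k jl.
have /(congr1 S) := cross_commutator j l ik; rewrite !raddfD /= !SM !SE => e2.
have h1 : u i j * u k l - u k l * u i j = u k j * u i l - u i l * u k j.
  by rewrite -(addrK (u i l * u k j) (u i j * u k l)) e1 addrAC addrK.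
have h2 : u k l * u i j - u i j * u k l = u k j * u i l - u i l * u k j.
  by rewrite -(addrK (u i l * u k j) (u k l * u i j)) e2 addrAC addrK.
apply/eqP; rewrite -subr_eq0; apply/eqP/addr_self_eq0.
by rewrite {1}h1 -h2 subrKA subrr.
Qed.

End Anticommutation.

End Maximality.

(** * Non-inclusions *)

Section NonInclusions.
Variables (R : realType) (N : nat).
Implicit Types (A : cstarAlgType R).

Lemma diag_symmetries_orthogonal A (v : 'I_N -> A) : symmetries v ->
  orthogonal_rel (\matrix_(i, j) (if i == j then v i else 0)).
Proof.
move=> vS; apply/orthogonal_relP; split=> [i j|i k|j l].
- by rewrite mxE; case: eqVneq; rewrite ?star0 ?(vS _).1.
- rewrite (bigD1 i)//= !mxE eqxx eq_sym big1 ?addr0 => [|j ji].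
    by have [->|_] := eqVneq i k; rewrite ?(vS _).2 ?mulr0.
  by rewrite mxE eq_sym (negPf ji) mul0r.
- rewrite (bigD1 j)//= !mxE eqxx big1 ?addr0 => [|i ij].
    by have [->|_] := eqVneq j l; rewrite ?(vS _).2 ?mulr0.
  by rewrite mxE (negPf ij) mul0r.
Qed.

Lemma diag_symmetries_Hstar A (v : 'I_N -> A) : half_commuting v ->
  Hstar_rel (\matrix_(i, j) (if i == j then v i else 0)).
Proof.
move=> vH; split; [split=> i j k jk|].
- rewrite !mxE; have [->|_] := eqVneq i j; last by rewrite mul0r.
  by rewrite (negPf jk) mulr0.
- rewrite !mxE; have [<-|_] := eqVneq i k; last by rewrite mul0r.
  by rewrite eq_sym (negPf jk) mulr0.
- move=> i j k l p q; rewrite !mxE.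
  by case: (i == j); case: (k == l); case: (p == q); rewrite ?(mul0r, mulr0).
Qed.

(** The identity matrix with a 2 x 2 block of rows (a, b) and (b, a) at i0 and i1. Anticommutation
    of a and b takes over the role of the sign in a rotation matrix, and the symmetry of the matrix
    reduces columns to rows. *)
Definition corner A (a b : A) (i0 i1 : 'I_N) : 'M[A]_N :=
  \matrix_(i, j) (if (i \in [:: i0; i1]) && (j \in [:: i0; i1])
                  then if i == j then a else b else (i == j)%:R).

Section Corner.
Variables (A : cstarAlgType R) (a b : A) (i0 i1 : 'I_N).
Hypotheses (i01 : i0 != i1) (sa : star a = a) (sb : star b = b).
Hypotheses (ab : a * b = - (b * a)) (ab1 : a * a + b * b = 1).
Local Notation u := (corner a b i0 i1).
Local Notation S := ([:: i0; i1]).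

Lemma corner_sym i j : u i j = u j i.
Proof. by rewrite !mxE andbC eq_sym. Qed.

Lemma corner_out i j : i \notin S -> u i j = (i == j)%:R.
Proof. by move=> iS; rewrite mxE (negPf iS). Qed.

Lemma corner_outr i j : j \notin S -> u i j = (i == j)%:R.
Proof. by move=> jS; rewrite corner_sym corner_out// eq_sym. Qed.

Lemma corner_in i j : i \in S -> j \in S -> u i j = if i == j then a else b.
Proof. by move=> iS jS; rewrite mxE iS jS. Qed.

Lemma corner_row i k : \sum_j u i j * u k j = (i == k)%:R.
Proof.
have [iS|iS] := boolP (i \in S); last first.
  rewrite (bigD1 i)//= corner_out// eqxx mul1r corner_sym corner_out// big1 ?addr0//.
  by move=> j ji; rewrite corner_out// eq_sym (negPf ji) mul0r.
have [kS|kS] := boolP (k \in S); last first.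
  rewrite (bigD1 k)//= (@corner_out k k)// eqxx mulr1 corner_outr// big1 ?addr0//.
  by move=> j jk; rewrite (corner_out _ kS) eq_sym (negPf jk) mulr0.
have inS j : (j \in S) = (j == i0) || (j == i1) by rewrite !inE.
rewrite (bigD1 i0)//= (bigD1 i1) 1?eq_sym//= big1 ?addr0 => [|j /andP[j0 j1]]; last first.
  have jS : j \notin S by rewrite inS negb_or j0.
  rewrite corner_outr// (negPf (_ : i != j)) ?mul0r//.
  by apply: contraNneq jS => <-.
rewrite !corner_in// ?inS ?eqxx ?orbT//.
move: iS kS; rewrite !inS => /orP[]/eqP-> /orP[]/eqP->;
  rewrite ?eqxx ?(negPf i01) ?[i1 == i0]eq_sym ?(negPf i01)//.
- by rewrite ab addNr.
- by rewrite ab addrN.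
- by rewrite addrC.
Qed.

Lemma corner_orthogonal : orthogonal_rel u.
Proof.
apply/orthogonal_relP; split=> [i j|i k|j l].
- by rewrite mxE; case: ifP => _; case: (i == j); rewrite ?sa ?sb ?star1 ?star0.
- exact: corner_row.
- by rewrite -corner_row; apply: eq_bigr => i _; rewrite !(corner_sym i).
Qed.

Lemma corner_anticommute i j l : j != l -> u i j * u i l = - (u i l * u i j).
Proof.
move=> jl; have [iS|iS] := boolP (i \in S); last first.
  rewrite !corner_out//; have [->|_] := eqVneq i j; last by rewrite mulr0 mul0r oppr0.
  by rewrite (negPf jl) mulr0 mul0r oppr0.
have out m : m \notin S -> u i m = 0.
  by move=> mS; rewrite corner_outr// (negPf (_ : i != m))//; apply: contraNneq mS => <-.
have [jS|/out->] := boolP (j \in S); last by rewrite mulr0 mul0r oppr0.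
have [lS|/out->] := boolP (l \in S); last by rewrite mulr0 mul0r oppr0.
rewrite !corner_in//; move: iS jS lS jl; rewrite !inE.
by do 3![move=> /orP[]/eqP->];
  rewrite ?eqxx ?(negPf i01) ?[i1 == i0]eq_sym ?(negPf i01)// ab ?opprK.
Qed.

Lemma corner_barO : barO_rel u.
Proof.
split=> [i j l jl|i k j ik|i j k l ik jl]; first exact: corner_anticommute.
  by rewrite !(corner_sym _ j) corner_anticommute.
have comm i' j' (x : A) : (i' == j')%:R * x = x * (i' == j')%:R.
  by case: (i' == j'); rewrite ?(mul1r, mulr1, mul0r, mulr0).
have [iS|iS] := boolP (i \in S); last by rewrite (corner_out _ iS) comm.
have [jS|jS] := boolP (j \in S); last by rewrite (corner_outr _ jS) comm.
have [kS|kS] := boolP (k \in S); last by rewrite (corner_out _ kS) comm.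
have [lS|lS] := boolP (l \in S); last by rewrite (corner_outr _ lS) comm.
(* Inside the block, two entries on distinct rows and distinct columns are equal: both a or both
   b. *)
rewrite !corner_in//; move: iS jS kS lS ik jl; rewrite !inE.
by do 4![move=> /orP[]/eqP->]; rewrite ?eqxx ?(negPf i01) ?[i1 == i0]eq_sym ?(negPf i01).
Qed.

End Corner.

Variables (barO Hstar : qmatrix R N).
Hypotheses (barOP : is_barO barO) (HstarP : is_Hstar Hstar) (N_gt1 : (1 < N)%N).
Local Notation C := ((R[i])^o : cstarAlgType R).

Let i0 : 'I_N := Ordinal (ltnW N_gt1).
Let i1 : 'I_N := Ordinal N_gt1.

Lemma Hstar_not_barO : ~ qsub Hstar barO.
Proof.
(* Reflections of Z/3 half-commute, but those of weights 0 and 1 do not commute: the two orders move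
   0 to 1 and to 2, so the entry at (0, 1) tells them apart. *)
move=> [f fs fE]; pose s p (x : 'Z_3) : 'Z_3 := (p == i1)%:R - x.
have ss p : involutive (s p) by move=> x; rewrite /s subKr.
have sH : half_commuting (pmx C (n := 2) \o s).
  by move=> a b c; rewrite /= !pmx_mul; apply: eq_pmx => x /=; rewrite /s; ring.
have [h hs hE] := qgroup_presented_univ HstarP
  (diag_symmetries_orthogonal (pmx_symmetries C ss)) (diag_symmetries_Hstar sH).
have [_ [_ _ comm]] := qgroup_presented_rel barOP.
have /(congr1 f)/(congr1 h) := comm i0 i0 i1 i1 isT isT.
rewrite !rmorphM /= !fE !hE !mxE /= !pmx_mul => /matrixP/(_ 0 1).
rewrite !pmxE -!val_eqE /= => /eqP.
exact/negP/oner_neq0.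
Qed.

Lemma barO_not_Hstar : ~ qsub barO Hstar.
Proof.
move=> [f fs fE].
(* The Pythagorean triple 3, 4, 5 gives x^2 + y^2 = 1 with x and y nonzero. The matrices a and b are
   x and y times two anticommuting Pauli matrices, and a b, which the relations of H_N^+ would make
   zero, has the entry x y. *)
pose x : R := 3%:R / 5%:R; pose y : R := 4%:R / 5%:R.
pose a : cmx C 1 := \matrix_(s, t)
  (if s == t then (if s == 0 then x%:C else - x%:C) else 0).
pose b : cmx C 1 := \matrix_(s, t) (if s == t then 0 else y%:C).
have sa : star a = a.
  apply/matrixP => s t; rewrite !mxE eq_sym; have [->|_] := eqVneq s t; last exact: star0.
  by case: ifP => _; rewrite ?starN; congr (- _) || idtac; exact: conj_real.
have sb : star b = b.
  apply/matrixP => s t; rewrite !mxE eq_sym; case: (s == t); first exact: star0.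
  exact: conj_real.
have ord2 (s : 'I_2) : s = 0 \/ s = 1.
  by case: s => [[|[|//]] ?]; [left|right]; apply/val_inj.
have ab : a * b = - (b * a).
  apply/matrixP => s t; rewrite !mxE !big_ord_recl !big_ord0 !mxE /=.
  by have [->|->] := ord2 s; have [->|->] := ord2 t; rewrite /=; ring.
have ab1 : a * a + b * b = 1.
  have xy : x%:C * x%:C + y%:C * y%:C = 1 :> R[i].
    rewrite -!rmorphM -rmorphD -(rmorph1 (real_complex R)); congr _%:C.
    by rewrite /x /y; field.
  apply/matrixP => s t; rewrite !mxE !big_ord_recl !big_ord0 !mxE /=.
  by have [->|->] := ord2 s; have [->|->] := ord2 t; rewrite /= -?xy; ring.
have i01 : i0 != i1 by [].
have [h hs hE] := qgroup_presented_univ barOP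
  (corner_orthogonal i01 sa sb ab ab1) (corner_barO i01 ab).
have [_ [[row _] _]] := qgroup_presented_rel HstarP.
have /(congr1 f)/(congr1 h) := row i0 i0 i1 i01.
rewrite !rmorphM /= !fE !hE !rmorph0 !corner_in ?inE ?eqxx// (negPf i01).
move=> /matrixP/(_ 0 1); rewrite !mxE !big_ord_recl !big_ord0 !mxE /=.
rewrite mul0r !addr0 -rmorphM => /complexI/eqP.
by rewrite !mulf_eq0 invr_eq0 !pnatr_eq0.
Qed.

End NonInclusions.

(** * Quantum isometry groups of the cubes *)

Section IsometryGroups.
Variables (R : realType) (N : nat).
Hypothesis N_gt0 : (0 < N)%N.

Lemma commuting_map : cube_rel_map (@commuting R N).
Proof. by move=> A B f v _ vC a b; rewrite /= -!rmorphM vC. Qed.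

Lemma half_commuting_map : cube_rel_map (@half_commuting R N).
Proof. by move=> A B f v _ vH a b c; rewrite /= -!rmorphM vH. Qed.

Lemma cube_isometries (X : qspace R N) (G : qmatrix R N) :
  is_dual (@Z2pow_gen N) X -> is_barO G -> quantum_affine_isometry_group X G.
Proof.
move=> /cube_presented[g gP] GP; split.
- exact: qgroup_presented_subgroup (@barO_mul R N) (@barO_map R N) (@barO_opp R N)
    (@barO_one R N) GP.
- apply: presented_acts (@barO_one R N) (@barO_map R N) commuting_map _ GP gP.
  move=> A u v uv uO PU vS vC; split; first exact: barO_symmetries.
  exact: barO_commuting.
- move=> H HS HX; apply: (qgroup_presented_sub GP HS).
  have act j l := acts_qperm N_gt0 commuting_map gP HX
    (kleinK j l) (klein_commuting H j l).
  have sym j l := (act j l).1; have comm j l := (act j l).2.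
  split.
  + exact: row_anticommute sym.
  + exact: column_anticommute HS sym.
  + exact: distinct_commute HS comm.
Qed.

Lemma half_cube_isometries (X : qspace R N) (G : qmatrix R N) :
  is_dual (@Z2half_gen N) X -> is_Hstar G -> quantum_affine_isometry_group X G.
Proof.
move=> /half_cube_presented[g gP] GP; split.
- exact: qgroup_presented_subgroup (@Hstar_mul R N) (@Hstar_map R N) (@Hstar_opp R N)
    (@Hstar_one R N) GP.
- apply: presented_acts (@Hstar_one R N) (@Hstar_map R N) half_commuting_map _ GP gP.
  move=> A u v uv uO PU vS vH; split; first exact: Hplus_symmetries PU.1.
  exact: Hstar_half.
- move=> H HS HX; apply: (qgroup_presented_sub GP HS).
  have act d := acts_qperm N_gt0 half_commuting_map gP HX
    (reflectionK d) (reflection_half H d).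
  have row := row_products_eq0 (fun d => (act d).1).
  split; first split.
  + exact: row.
  + exact: column_products_eq0 HS row.
  + by move=> i j k l p q; exact: qfund_half_commute HS row (fun d => (act d).2) _ _ _ _ _ _.
Qed.

Lemma free_cube_isometries (X : qspace R N) (G : qmatrix R N) :
  is_dual (@Z2free_gen N) X -> is_Hplus G -> quantum_affine_isometry_group X G.
Proof.
move=> /free_cube_presented[g gP] GP; split.
- exact: qgroup_presented_subgroup (@Hplus_mul R N) (@Hplus_map R N) (@Hplus_opp R N)
    (@Hplus_one R N) GP.
- apply: presented_acts (@Hplus_one R N) (@Hplus_map R N) _ _ GP gP => //.
  by move=> A u v uv uO PU vS _; split=> //; exact: Hplus_symmetries PU.
- move=> H HS HX; apply: (qgroup_presented_sub GP HS).
  have act d : symmetries (qperm H (reflection d)) /\ True.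
    have Tmap : cube_rel_map (fun (A : cstarAlgType R) (_ : 'I_N -> A) => True) by [].
    exact: (acts_qperm N_gt0 Tmap gP HX (reflectionK d) I).
  have row := row_products_eq0 (fun d => (act d).1).
  by split; [exact: row|exact: column_products_eq0 HS row].
Qed.

Lemma cube_presented_sub (Q Q' : forall A : cstarAlgType R, ('I_N -> A) -> Prop)
    (X Y : qspace R N) (g : 'I_N -> X) (h : 'I_N -> Y) :
  (forall A v, Q A v -> Q' A v) -> cube_presented_by Q g -> cube_presented_by Q' h ->
  ssub X Y.
Proof.
move=> QQ' [[[gS gQ] _ _] xE] [[_ _ univ] yE].
have [f fs fE] := univ X g (conj gS (QQ' _ _ gQ)); exists f => // i.
by rewrite xE yE linearZ /= fE.
Qed.

Lemma cube_presented_sphere (Q : forall A : cstarAlgType R, ('I_N -> A) -> Prop)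
    (X : qspace R N) (g : 'I_N -> X) : cube_presented_by Q g -> sphere_subset X.
Proof.
move=> [[[gS _] gen _] xE]; have N0 : (N%:R : R[i]) != 0 by rewrite pnatr_eq0 -lt0n.
have s0 : sqrtC (N%:R : R[i]) != 0 by rewrite sqrtC_eq0.
split.
- move=> i; rewrite xE starZ (gS i).1; congr (_ *: _).
  by apply/CrealP; rewrite rpredV; apply/ger0_real; rewrite sqrtC_ge0 ler0n.
- under eq_bigr do rewrite xE exprZn (expr2 (g _)) (gS _).2 exprVn sqrtCK.
  rewrite -scaler_suml sumr_const card_ord -[_ *+ N]mulr_natl mulfV//.
  by rewrite scale1r.
- apply: generates_sub gen => S cS XS _ [i _ <-].
  have -> : g i = sqrtC N%:R *: scoord X i by rewrite xE scalerA mulfV// scale1r.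
  by apply: subalgebra_scale cS _; apply: XS; exists i.
Qed.

End IsometryGroups.

(** The non-inclusions concern N > 1: for N = 1, both groups are given by a single self-adjoint u
    with u^2 = 1 and coincide. *)
Theorem theorem3p7 (R : realType) (N : nat) (N_gt0 : (0 < N)%N)
    (cube half_cube free_cube : qspace R N)
    (barO Hstar Hplus : qmatrix R N)
    (cubeP : is_dual (@Z2pow_gen N) cube)
    (half_cubeP : is_dual (@Z2half_gen N) half_cube)
    (free_cubeP : is_dual (@Z2free_gen N) free_cube)
    (barOP : is_barO barO)
    (HstarP : is_Hstar Hstar)
    (HplusP : is_Hplus Hplus) :
  [/\ sphere_subset free_cube, ssub cube half_cube & ssub half_cube free_cube] /\
  [/\ quantum_affine_isometry_group cube barO,
      quantum_affine_isometry_group half_cube Hstar &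
      quantum_affine_isometry_group free_cube Hplus] /\
  qsub Hstar Hplus /\
  ((1 < N)%N -> ~ qsub barO Hstar /\ ~ qsub Hstar barO).
Proof.
have [g1 g1P] := cube_presented cubeP.
have [g2 g2P] := half_cube_presented half_cubeP.
have [g3 g3P] := free_cube_presented free_cubeP.
split; first split.
- exact: cube_presented_sphere g3P.
- apply: cube_presented_sub g1P g2P => A v vC a b c.
  by rewrite (vC a b) -mulrA (vC a c) mulrA (vC b c).
- exact: cube_presented_sub g2P g3P.
split; first split.
- exact: cube_isometries.
- exact: half_cube_isometries.
- exact: free_cube_isometries.
split.
  have [uO [uP _]] := qgroup_presented_rel HstarP.
  exact: qgroup_presented_univ HplusP uO uP.
by move=> N_gt1; split; [exact: barO_not_Hstar|exact: Hstar_not_barO].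
Qed.
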